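(* Let $d\ge2$ be an integer, let $\theta$ be an arbitrary antisymmetric real $d\times d$ matrix, and let $0<p\le d$. If $x\in L_2(\mathbb{T}^d_\theta)$ and $đx\in\mathcal{L}_p$ (that is, $đx$, initially defined on $C^\infty(\mathbb{T}^d_\theta)\otimes\mathbb{C}^N$, has a bounded extension in the Schatten ideal $\mathcal{L}_p$), then $x$ is a constant, i.e. $x\in\mathbb{C}1$.
   Context: Quantum torus: $C(\mathbb{T}^d_\theta)$ is the universal $C^*$-algebra generated by unitaries $U_1,\dots,U_d$ with $U_jU_k=e^{2\pi \mathrm{i}\theta_{j,k}}U_kU_j$; $U^n:=U_1^{n_1}\cdots U_d^{n_d}$ for $n\in\mathbb{Z}^d$. $\tau$ is the canonical tracial state, with $\tau(U^n)=\delta_{n,0}$. $L_2(\mathbb{T}^d_\theta)$ is the GNS Hilbert space of $\tau$, on which $C(\mathbb{T}^d_\theta)$ acts by left multiplication. Fourier coefficients: $\widehat x(n)=\tau(x(U^n)^* )$. $C^\infty(\mathbb{T}^d_\theta)$ is the space of $x\in C(\mathbb{T}^d_\theta)$ whose Fourier coefficients decay rapidly. Derivatives: $\partial_j(U^n)=2\pi \mathrm{i}\,n_jU^n$; $D_j=-\mathrm{i}\partial_j$. Dirac operator: $N=2^{\lfloor d/2\rfloor}$; $\gamma_1,\dots,\gamma_d$ are self-adjoint $N\times N$ complex matrices with $\gamma_j\gamma_k+\gamma_k\gamma_j=2\delta_{j,k}1$; $D=\sum_{j=1}^d\gamma_j\otimes D_j$ is a self-adjoint operator on $\mathbb{C}^N\otimes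 L_2(\mathbb{T}^d_\theta)$, and $\mathrm{sgn}(D)=\sum_{j=1}^d\gamma_j\otimes\frac{D_j}{\sqrt{D_1^2+\cdots+D_d^2}}$, taken to be $0$ on $\mathbb{C}^N\otimes\mathbb{C}1$. Quantised differential: $M_x$ denotes left multiplication $y\mapsto xy$. For $x\in L_2(\mathbb{T}^d_\theta)$, $đx$ is defined on $C^\infty(\mathbb{T}^d_\theta)\otimes\mathbb{C}^N$ by $(đx)\eta=\mathrm{i}\,\mathrm{sgn}(D)(1\otimes M_x)\eta-\mathrm{i}\,(1\otimes M_x)\mathrm{sgn}(D)\eta$. Ideals: for $p\in(0,\infty)$, $\mathcal{L}_p$ is the set of compact operators $T$ whose singular value sequence is in $\ell_p$. *)

(* Defs.v *)
From HB Require Import structures.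
From mathcomp Require Import all_boot all_order all_algebra complex.
From mathcomp Require Import boolp classical_sets functions cardinality reals ereal.
From mathcomp Require Import topology normedtype sequences exp trigo.
From mathcomp Require summability.

Set Implicit Arguments.
Unset Strict Implicit.
Unset Printing Implicit Defensive.

Import Order.TTheory GRing.Theory Num.Theory.
Import numFieldNormedType.Exports.

Local Open Scope classical_set_scope.
Local Open Scope complex_scope.
Local Open Scope ring_scope.

HB.mixin Record isHilbert (R : realType) V & CompleteNormedModule R[i] V := {
  inner : {dot V for Num.conj};
  normEinner : forall v : V, `|v| = sqrtC (inner v v)
}.

#[short(type="hilbertType")]
HB.structure Definition Hilbert (R : realType) :=
  {V of isHilbert R V & CompleteNormedModule R[i] V}.

(* [hsum n V] is the Hilbert space [C^n (x) V], realised as [V^n]: the vector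
   [e_k (x) v] of [C^n (x) V] is the family equal to [v] at [k] and [0]
   elsewhere. *)
Definition hsum (R : realType) (n : nat) (V : hilbertType R) :=
  {ffun 'I_n -> V}.

Lemma inner_ge0 (R : realType) (V : hilbertType R) (v : V) : 0 <= inner v v.
Proof.
have [->|/neq0_dnorm_gt0/ltW//] := eqVneq v 0.
by rewrite linear0r.
Qed.

Section hsum.
Variables (R : realType) (n : nat) (V : hilbertType R).
Local Notation K := (hsum n V).
HB.instance Definition _ := GRing.Lmodule.on K.

Definition hsum_inner (u v : K) : R[i] := \sum_k inner (u k) (v k).

Lemma hsum_inner_zmodl v : zmod_morphism (hsum_inner^~ v).
Proof.
move=> a b; rewrite /hsum_inner -sumrB; apply: eq_bigr => k _.
by rewrite !ffunE linearBl.
Qed.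
Lemma hsum_inner_zmodr v : zmod_morphism (hsum_inner v).
Proof.
move=> a b; rewrite /hsum_inner -sumrB; apply: eq_bigr => k _.
by rewrite !ffunE linearBr.
Qed.
Lemma hsum_inner_scalel v : scalable_for *%R (hsum_inner^~ v).
Proof.
move=> a b; rewrite /hsum_inner mulr_sumr; apply: eq_bigr => k _.
by rewrite !ffunE linearZl.
Qed.
Lemma hsum_inner_scaler v : scalable_for (Num.conj \; *%R) (hsum_inner v).
Proof.
move=> a b; rewrite /hsum_inner /= mulr_sumr; apply: eq_bigr => k _.
by rewrite !ffunE linearZr.
Qed.
Lemma hsum_inner_herm u v : hsum_inner u v = (-1) ^+ false * (hsum_inner v u)^*.
Proof.
rewrite expr0 mul1r /hsum_inner rmorph_sum; apply: eq_bigr => k _.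
by rewrite [LHS]hermC expr0 mul1r.
Qed.
Lemma hsum_inner_gt0 u : u != 0 -> 0 < hsum_inner u u.
Proof.
move=> u0; rewrite lt_def sumr_ge0 => [|k _]; last exact: inner_ge0.
rewrite andbT; apply: contra u0 => /eqP/psumr_eq0P u0.
apply/eqP/ffunP => k; rewrite ffunE; apply/eqP; rewrite -normr_eq0 normEinner.
by rewrite u0 ?sqrtC0// => i _; exact: inner_ge0.
Qed.

HB.instance Definition _ := isBilinear.Build R[i] K K R[i]
  *%R (Num.conj \; *%R) hsum_inner
  hsum_inner_zmodl hsum_inner_zmodr hsum_inner_scalel hsum_inner_scaler.
HB.instance Definition _ := isHermitianSesquilinear.Build R[i] K
  false Num.conj hsum_inner hsum_inner_herm.
HB.instance Definition _ := isDotProduct.Build R[i] K hsum_inner hsum_inner_gt0.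

Definition hsum_norm (u : K) : R[i] := sqrtC (hsum_inner u u).

Let ip_ge0 (u : K) : 0 <= hsum_inner u u.
Proof. by apply: sumr_ge0 => k _; exact: inner_ge0. Qed.

Lemma hsum_CauchySchwarz (u v : K) :
  `|hsum_inner u v| <= hsum_norm u * hsum_norm v.
Proof.
have [->|v0] := eqVneq v 0.
  by rewrite linear0r normr0 mulr_ge0 // sqrtC_ge0.
have v_gt0 := hsum_inner_gt0 v0.
pose a := hsum_inner u v / hsum_inner v v; pose w := u - a *: v.
have wv : hsum_inner w v = 0.
  by rewrite linearBl/= linearZl_LR/= divfK ?subrr// gt_eqF.
have uE : hsum_inner u u = hsum_inner w w + `|a| ^+ 2 * hsum_inner v v.
  rewrite -[u in LHS](subrK (a *: v)) -/w hnormDd/=; last first.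
    by rewrite linearZr_LR/= wv mulr0.
  by rewrite linearZl_LR linearZr_LR/= mulrA -normCK.
rewrite -sqrtCM ?nnegrE// -[leLHS]sqrCK// ler_sqrtC ?nnegrE ?exprn_ge0 ?mulr_ge0//.
rewrite uE mulrDl -mulrA -expr2 -(ger0_norm (ip_ge0 v)) -exprMn -normrM.
by rewrite divfK ?gt_eqF// ger0_norm// lerDr mulr_ge0.
Qed.

Lemma hsum_normD u v : hsum_norm (u + v) <= hsum_norm u + hsum_norm v.
Proof.
have n_ge0 (w : K) : 0 <= hsum_norm w by rewrite sqrtC_ge0.
rewrite -[leRHS]sqrCK ?addr_ge0// ler_sqrtC ?nnegrE ?exprn_ge0 ?addr_ge0//.
rewrite hnormD/= expr0 mul1r sqrrD !sqrtCK [leRHS]addrAC lerD2l.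
have := hsum_CauchySchwarz u v; set z := hsum_inner u v => le_z.
have zR : z + z^* \is Num.real by rewrite CrealE rmorphD/= conjCK addrC.
apply: (le_trans (real_ler_norm zR)); apply: (le_trans (ler_normD _ _)).
by rewrite norm_conjC -mulr2n lerMn2r le_z orbT.
Qed.

Lemma hsum_normZ (l : R[i]) u : hsum_norm (l *: u) = `|l| * hsum_norm u.
Proof.
rewrite /hsum_norm linearZl_LR linearZr_LR/= mulrA -normCK.
by rewrite sqrtCM ?nnegrE ?exprn_ge0// sqrCK.
Qed.

Lemma hsum_norm0_eq0 u : hsum_norm u = 0 -> u = 0.
Proof.
move=> /eqP; rewrite sqrtC_eq0; apply: contraTeq => /hsum_inner_gt0.
by move/gt_eqF ->.
Qed.

HB.instance Definition _ := Lmodule_isNormed.Build R[i] K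
  hsum_normD hsum_normZ hsum_norm0_eq0.

Lemma hsum_normE (u : K) : `|u| = sqrtC (hsum_inner u u).
Proof. by []. Qed.

Lemma hsum_coord_le (u : K) k : `|u k| <= `|u|.
Proof.
rewrite hsum_normE normEinner ler_sqrtC ?nnegrE ?inner_ge0//.
by rewrite /hsum_inner (bigD1 k)//= lerDl sumr_ge0// => i _; exact: inner_ge0.
Qed.

Lemma hsum_le_coord (u : K) (e : R[i]) : 0 <= e ->
  (forall k, `|u k| <= e) -> `|u| <= sqrtC n%:R * e.
Proof.
move=> e0 ue; rewrite hsum_normE -[e in leRHS]sqrCK// -sqrtCM ?nnegrE ?exprn_ge0//.
rewrite ler_sqrtC ?nnegrE ?mulr_ge0 ?exprn_ge0//.
rewrite -[in leRHS](card_ord n) mulr_natl -sumr_const.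
apply: ler_sum => k _; rewrite -[inner _ _]sqrtCK -normEinner.
by rewrite lerXn2r ?nnegrE// normEinner sqrtC_ge0 inner_ge0.
Qed.

Lemma hsum_complete (F : set_system K) : ProperFilter F -> cauchy F -> cvg F.
Proof.
move=> FF /cauchy_ballP cF.
have cvk k : cvg ((fun u : K => u k) @ F).
  apply/cauchy_cvgP/cauchy_ballP => e e0.
  have [[A B] [/= FA FB] AB] := cF e e0.
  exists ([set u k | u in A], [set u k | u in B]) => /=.
    by split; [apply: filterS FA => u Au; exists u | apply: filterS FB => u Bu; exists u].
  move=> [_ _] /= [[u Au <-] [v Bv <-]].
  have /= := AB (u, v) (conj Au Bv).
  rewrite -!ball_normE /=; apply: le_lt_trans.
  by have := hsum_coord_le (u - v) k; rewrite !ffunE.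
pose l : K := [ffun k => lim ((fun u : K => u k) @ F)].
apply/cvg_ex; exists l; apply/cvgrPdist_le => e e0.
pose c : R[i] := sqrtC n%:R + 1.
have c0 : 0 < c by rewrite ltr_wpDl// sqrtC_ge0.
have nearF k : \forall u \near F, `|l k - (u : K) k| <= e / c.
  rewrite ffunE; move: (cvk k) => /cvgrPdist_le; apply; exact: divr_gt0.
have : \forall u \near F, forall k, `|l k - (u : K) k| <= e / c.
  exact: filter_forall.
apply: filterS => u lu; apply: (@le_trans _ _ (sqrtC n%:R * (e / c))).
  apply: hsum_le_coord => [|k]; first by rewrite divr_ge0 ?ltW.
  by have := lu k; rewrite !ffunE.
rewrite mulrA ler_pdivrMr// mulrC ler_pM2l//.
by rewrite lerDl.
Qed.

HB.instance Definition _ := Uniform_isComplete.Build K hsum_complete.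
HB.instance Definition _ := isHilbert.Build R K hsum_normE.
End hsum.

Section schatten.
Variables (R : realType) (K : hilbertType R).

Definition opnorm (T : K -> K) : R :=
  sup [set complex.Re `|T v| | v in [set v | `|v| <= 1]].

Definition rank_le (k : nat) (T : K -> K) :=
  exists e : 'I_k -> K,
    forall v, exists c : 'I_k -> R[i], T v = \sum_i c i *: e i.

(* [singular_value T 0] is the operator norm of [T]. *)
Definition singular_value (T : K -> K) (k : nat) : R :=
  inf [set opnorm (fun v => T v - F v)
      | F in [set F : {linear K -> K} | continuous F /\ rank_le k F]].

Definition compact_operator (T : {linear K -> K}) :=
  precompact (T @` [set v | `|v| <= 1]).

Definition schatten (p : R) (T : {linear K -> K}) :=
  compact_operator T /\
  (\sum_(0 <= k <oo) (singular_value T k `^ p)%:E < +oo)%E.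

End schatten.

(* Unital and nonzero.  The norm takes its values in [R[i]], as for
   [normedModType R[i]]; MathComp has no join of the ring and normed module
   structures. *)
HB.mixin Record isCStar (R : realType) A & GRing.Algebra R[i] A := {
  star : A -> A;
  starD : forall a b : A, star (a + b) = star a + star b;
  starZ : forall (c : R[i]) (a : A), star (c *: a) = Num.conj c *: star a;
  starM : forall a b : A, star (a * b) = star b * star a;
  starK : involutive star;
  cnorm : A -> R[i];
  cnorm0_eq0 : forall a : A, cnorm a = 0 -> a = 0;
  cnormD : forall a b : A, cnorm (a + b) <= cnorm a + cnorm b;
  cnormZ : forall (c : R[i]) (a : A), cnorm (c *: a) = `|c| * cnorm a;
  cnormM : forall a b : A, cnorm (a * b) <= cnorm a * cnorm b;
  cnorm_star : forall a : A, cnorm (star a * a) = cnorm a ^+ 2;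
  cnorm_complete : forall a_ : nat -> A,
    (forall e : R[i], 0 < e ->
      \forall m \near \oo & n \near \oo, cnorm (a_ m - a_ n) < e) ->
    exists a : A, forall e : R[i], 0 < e ->
      \forall n \near \oo, cnorm (a_ n - a) < e
}.

#[short(type="cstarType")]
HB.structure Definition CStar (R : realType) :=
  {A of isCStar R A & GRing.Algebra R[i] A}.

Section cstar.
Variables (R : realType) (A : cstarType R).

Definition closed_star_subalgebra (S : set A) :=
  [/\ S 1,
      forall a b, S a -> S b -> S (a + b) /\ S (a * b),
      forall (c : R[i]) a, S a -> S (c *: a),
      forall a, S a -> S (star a)
    & forall (a_ : nat -> A) a, (forall n, S (a_ n)) ->
        (forall e : R[i], 0 < e -> \forall n \near \oo, cnorm (a_ n - a) < e) ->
        S a].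

Definition generated_by (I : Type) (U : I -> A) :=
  forall S, closed_star_subalgebra S -> (forall i, S (U i)) -> S = setT.

Definition unitary (u : A) := star u * u = 1 /\ u * star u = 1.

Definition state (tau : {scalar A}) :=
  [/\ forall a, 0 <= tau (star a * a), forall a, `|tau a| <= cnorm a
    & tau 1 = 1].

(* [u ^ m] for a unitary [u], whose inverse is [star u]. *)
Definition upow (u : A) (m : int) : A :=
  match m with Posz k => u ^+ k | Negz k => star u ^+ k.+1 end.

Definition monomial (d : nat) (U : 'I_d -> A) (n : 'rV[int]_d) : A :=
  \prod_(j < d) upow (U j) (n 0 j).

End cstar.

Definition expi (R : realType) (t : R) : R[i] := cos t +i* sin t.

Definition torus_relations (R : realType) (d : nat) (theta : 'M[R]_d)
    (A : cstarType R) (U : 'I_d -> A) :=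
  (forall j, unitary (U j)) /\
  (forall j k, U j * U k = expi (2 * pi * theta j k) *: (U k * U j)).

(* [C(T^d_theta)] with its canonical trace and the GNS space of that trace;
   [Lambda : C(T^d_theta) -> L_2(T^d_theta)] is the canonical map, and each
   component is determined up to isomorphism. *)
Record quantumTorus (R : realType) (d : nat) (theta : 'M[R]_d) := QuantumTorus {
  CT : cstarType R;
  gen : 'I_d -> CT;
  gen_relations : torus_relations theta gen;
  gen_generate : generated_by gen;
  CT_universal : forall (B : cstarType R) (V : 'I_d -> B),
    torus_relations theta V ->
    exists phi : {lrmorphism CT -> B},
      (forall a, phi (star a) = star (phi a)) /\ (forall j, phi (gen j) = V j);
  trace : {scalar CT};
  trace_state : state trace;
  traceC : forall a b : CT, trace (a * b) = trace (b * a);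
  trace_monomial : forall n : 'rV[int]_d,
    trace (monomial gen n) = (n == 0)%:R;
  L2 : hilbertType R;
  Lambda : {linear CT -> L2};
  inner_Lambda : forall a b : CT,
    inner (Lambda a) (Lambda b) = trace (star b * a);
  Lambda_dense : dense (range Lambda)
}.

Section torus.
Variables (R : realType) (d : nat) (theta : 'M[R]_d) (X : quantumTorus theta).

Definition Umon (n : 'rV[int]_d) : CT X := monomial (@gen R d theta X) n.

Definition fourier (a : CT X) (n : 'rV[int]_d) : R[i] := trace X (a * star (Umon n)).

(* The same coefficients for [x] in [L_2], as
   [tau (a (U^n)^* ) = tau ((U^n)^* a) = inner (Lambda a) (Lambda (U^n))]. *)
Definition fourier2 (x : L2 X) (n : 'rV[int]_d) : R[i] :=
  inner x (Lambda X (Umon n)).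

Definition euclid (n : 'rV[int]_d) : R := Num.sqrt (\sum_j (n 0 j)%:~R ^+ 2).

Definition smooth (a : CT X) :=
  forall k : nat, exists M : R, forall n : 'rV[int]_d,
    `|fourier a n| * ((1 + euclid n) ^+ k)%:C <= M%:C.

(* The eigenvalue of [D_j = - i d_j] on [U^n], as [d_j U^n = 2 pi i n_j U^n]. *)
Definition D_eigenvalue (n : 'rV[int]_d) (j : 'I_d) : R[i] :=
  - 'i%C * (2 * pi%:C * 'i%C * (n 0 j)%:~R).

(* [f (D_1, ..., D_d)], in the orthonormal basis [(U^n)_n] of joint
   eigenvectors. *)
Definition funcalc (f : ('I_d -> R[i]) -> R[i]) (x : L2 X) : L2 X :=
  summability.sum (fun n : 'rV[int]_d =>
    (f (D_eigenvalue n) * fourier2 x n) *: Lambda X (Umon n)).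

(* Since [0 / 0 = 0], this vanishes at [xi = 0], so that the operator
   [D_j / sqrt (D_1^2 + ... + D_d^2)] is [0] on the constants. *)
Definition riesz (j : 'I_d) (xi : 'I_d -> R[i]) : R[i] :=
  xi j / sqrtC (\sum_k xi k ^+ 2).

(* [x * y] for [x] in [L_2] and [y = Lambda b] in the image of [C(T^d_theta)]:
   the value at [x] of the bounded extension of [Lambda a |-> Lambda (a * b)].
   (Only used for smooth [y]; it is [0] if [y] is not in that image.) *)
Definition mulL2 (x y : L2 X) : L2 X :=
  xget 0 [set z | exists (b : CT X) (a_ : nat -> CT X),
    [/\ y = Lambda X b,
        (fun m => Lambda X (a_ m)) @ \oo --> x
      & (fun m => Lambda X (a_ m * b)) @ \oo --> z]].

Section spinors.
Variables (N : nat) (gamma : 'I_d -> 'M[R[i]]_N).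

Definition clifford :=
  (forall j, map_mx Num.conj (gamma j)^T = gamma j) /\
  (forall j k, gamma j *m gamma k + gamma k *m gamma j = (2 * (j == k)%:R)%:M).

Definition sgnD (eta : hsum N (L2 X)) : hsum N (L2 X) :=
  [ffun i => \sum_j \sum_k gamma j i k *: funcalc (riesz j) (eta k)].

Definition mulop (x : L2 X) (eta : hsum N (L2 X)) : hsum N (L2 X) :=
  [ffun i => mulL2 x (eta i)].

Definition smooth_spinor (eta : hsum N (L2 X)) :=
  forall i, exists2 a : CT X, smooth a & eta i = Lambda X a.

Definition qdiff (x : L2 X) (eta : hsum N (L2 X)) : hsum N (L2 X) :=
  'i%C *: sgnD (mulop x eta) - 'i%C *: mulop x (sgnD eta).

Definition qdiff_in_schatten (p : R) (x : L2 X) :=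
  exists T : {linear hsum N (L2 X) -> hsum N (L2 X)},
    [/\ continuous T, forall eta, smooth_spinor eta -> T eta = qdiff x eta
      & schatten p T].

End spinors.
End torus.

(* Main.v *)
(* Let [e_n] be the image of [U^n] in [L_2], and [s xi = sum_j gamma_j xi_j / |xi|].
   The matrix coefficient of the quantised differential of [x] between [v (x) e_m]
   and [w (x) e_(m+q)] is, up to a phase, [<x, e_q> <(s (m+q) - s m) v, w>].  If
   [q <> 0] and [<x, e_q> <> 0], some [tr (gamma_b (s (m+q) - s m))] is of one sign
   and of size at least [c / K] on [K^d] lattice points [m], so that the sums of
   diagonal coefficients along [m |-> m + q] grow like [K^(d-1)].  For an operator
   in the Schatten class [p <= d] the [k]-th singular value is [o(k^(-1/d))], and
   the sum of [K^d] coefficients with respect to two orthonormal families is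
   [o(K^(d-1))]: this is seen by telescoping finite-rank approximations of ranks
   [2^(jd)].  Hence [<x, e_q> = 0] for all [q <> 0], and the [e_n] are complete. *)

Require Import Defs.
From mathcomp Require Import all_boot all_order all_algebra complex finmap.
From mathcomp Require Import boolp classical_sets reals ereal.
From mathcomp Require Import topology normedtype sequences exp trigo.
From mathcomp Require Import ring lra zify.
From mathcomp Require summability.

Set Implicit Arguments.
Unset Strict Implicit.
Unset Printing Implicit Defensive.

Import Order.TTheory GRing.Theory Num.Theory.
Import numFieldNormedType.Exports.

Local Open Scope classical_set_scope.
Local Open Scope complex_scope.
Local Open Scope ring_scope.

(** * Orthonormal families in Hilbert spaces *)

Section hilbert.
Variables (R : realType) (K : hilbertType R).
Implicit Types (u v w : K) (a c : R[i]).

Lemma innerC u v : inner u v = Num.conj (inner v u).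
Proof. by rewrite hermC expr0 mul1r. Qed.

Lemma innerDl u v w : inner (u + v) w = inner u w + inner v w.
Proof. exact: linearDl. Qed.

Lemma innerDr u v w : inner w (u + v) = inner w u + inner w v.
Proof. exact: linearDr. Qed.

Lemma innerBl u v w : inner (u - v) w = inner u w - inner v w.
Proof. exact: linearBl. Qed.

Lemma innerBr u v w : inner w (u - v) = inner w u - inner w v.
Proof. exact: linearBr. Qed.

Lemma innerZl a u w : inner (a *: u) w = a * inner u w.
Proof. by rewrite linearZl_LR. Qed.

Lemma innerZr a u w : inner u (a *: w) = Num.conj a * inner u w.
Proof. by rewrite linearZr_LR. Qed.

Lemma inner0l w : inner 0 w = 0.
Proof. exact: linear0l. Qed.

Lemma inner0r w : inner w 0 = 0.
Proof. exact: linear0r. Qed.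

Lemma inner_suml I (r : seq I) (P : pred I) (F : I -> K) w :
  inner (\sum_(i <- r | P i) F i) w = \sum_(i <- r | P i) inner (F i) w.
Proof.
elim/big_rec2: _ => [|i a u _ <-]; first exact: inner0l.
exact: innerDl.
Qed.

Lemma inner_sumr I (r : seq I) (P : pred I) (F : I -> K) w :
  inner w (\sum_(i <- r | P i) F i) = \sum_(i <- r | P i) inner w (F i).
Proof.
rewrite innerC inner_suml rmorph_sum; apply: eq_bigr => i _.
by rewrite [RHS]innerC.
Qed.

Lemma sqr_norm u : `|u| ^+ 2 = inner u u.
Proof. by rewrite normEinner sqrtCK. Qed.

Lemma CauchySchwarz_inner u v : `|inner u v| <= `|u| * `|v|.
Proof.
have := hsum_CauchySchwarz ([ffun=> u] : hsum 1 K) [ffun=> v].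
by rewrite /hsum_norm /hsum_inner !big_ord1 !ffunE -!normEinner.
Qed.

Definition orthonormal_family (I : eqType) (f : I -> K) :=
  forall i j, inner (f i) (f j) = (i == j)%:R.

Lemma orthonormal_comp (I J : eqType) (f : I -> K) (s : J -> I) :
  injective s -> orthonormal_family f -> orthonormal_family (f \o s).
Proof. by move=> s_inj f_on i j; rewrite /= f_on inj_eq. Qed.

Section finite_family.
Variables (I : finType) (f : I -> K).
Hypothesis f_on : orthonormal_family f.

Lemma inner_orthonormal_sum (c : I -> R[i]) j :
  inner (\sum_i c i *: f i) (f j) = c j.
Proof.
rewrite inner_suml (bigD1 j)//= innerZl f_on eqxx mulr1 big1 ?addr0// => i ij.
by rewrite innerZl f_on (negbTE ij) mulr0.
Qed.

Lemma inner_orthonormal_sum2 (a c : I -> R[i]) :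
  inner (\sum_i a i *: f i) (\sum_i c i *: f i) = \sum_i a i * Num.conj (c i).
Proof.
rewrite inner_sumr; apply: eq_bigr => i _.
by rewrite innerZr inner_orthonormal_sum mulrC.
Qed.

Lemma sqr_norm_orthonormal_sum (c : I -> R[i]) :
  `|\sum_i c i *: f i| ^+ 2 = \sum_i `|c i| ^+ 2.
Proof.
rewrite sqr_norm inner_orthonormal_sum2; apply: eq_bigr => i _.
by rewrite normCK.
Qed.

Lemma Bessel v : \sum_i `|inner v (f i)| ^+ 2 <= `|v| ^+ 2.
Proof.
pose w := \sum_i inner v (f i) *: f i.
have wE : inner v w = \sum_i `|inner v (f i)| ^+ 2.
  by rewrite inner_sumr; apply: eq_bigr => i _; rewrite innerZr normCK mulrC.
have w2 : inner w w = \sum_i `|inner v (f i)| ^+ 2.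
  by rewrite -sqr_norm sqr_norm_orthonormal_sum.
have : 0 <= inner (v - w) (v - w) by exact: inner_ge0.
have wv : inner w v = inner w w.
  by rewrite innerC wE w2 rmorph_sum; apply: eq_bigr => i _; rewrite rmorphXn/= conj_normC.
by rewrite innerBl !innerBr wv subrr subr0 wE sqr_norm subr_ge0.
Qed.

(** Bessel's inequality for the adjoint of [F] applied to [h]: [w] is the projection of that vector
    on the span of [f], and [<F w, h> = |w|^2 <= C |w|]. *)
Lemma Bessel_map (F : {linear K -> K}) (C : R[i]) (h : K) :
  0 <= C -> (forall v, `|F v| <= C * `|v|) -> `|h| <= 1 ->
  \sum_i `|inner (F (f i)) h| ^+ 2 <= C ^+ 2.
Proof.
move=> C0 FC h1; pose w := \sum_i Num.conj (inner (F (f i)) h) *: f i.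
have w2 : `|w| ^+ 2 = \sum_i `|inner (F (f i)) h| ^+ 2.
  by rewrite sqr_norm_orthonormal_sum; apply: eq_bigr => i _; rewrite norm_conjC.
have Fw : inner (F w) h = `|w| ^+ 2.
  rewrite w2 linear_sum inner_suml; apply: eq_bigr => i _.
  by rewrite linearZ/= innerZl mulrC -normCK.
have : `|w| ^+ 2 <= C * `|w|.
  have := CauchySchwarz_inner (F w) h.
  rewrite Fw ger0_norm ?exprn_ge0// => /le_trans; apply.
  by rewrite (le_trans _ (FC w))// ler_piMr.
rewrite -w2; have [->|w0] := eqVneq w 0; first by rewrite normr0 expr0n exprn_ge0.
rewrite expr2 ler_pM2r ?normr_gt0// => wC.
by rewrite -expr2 lerXn2r ?nnegrE.
Qed.

End finite_family.

(** Gram-Schmidt, with [h] orthonormal up to zero vectors: a linearly dependent [e] then keeps the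
    index type ['I_k], and only [|h i| <= 1] survives. *)
Lemma rank_le_basis (k : nat) (F : K -> K) : rank_le k F ->
  exists h : 'I_k -> K, (forall i, `|h i| <= 1) /\
    forall v, F v = \sum_i inner (F v) (h i) *: h i.
Proof.
move=> [e Fe].
suff [h ho he] : exists2 h : 'I_k -> K,
    forall i j, inner (h i) (h j) = ((i == j) && (h i != 0))%:R
    & forall i, e i = \sum_j inner (e i) (h j) *: h j.
  exists h; split=> [i|v].
    by rewrite -(@expr_le1 _ 2)// sqr_norm ho eqxx lern1 leq_b1.
  have [c ->] := Fe v.
  under [RHS]eq_bigr do rewrite inner_suml scaler_suml.
  rewrite exchange_big/=; apply: eq_bigr => i _.
  by rewrite {1}he scaler_sumr; apply: eq_bigr => j _; rewrite innerZl scalerA.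
elim: k e {Fe} => [|k IH] e; first by exists e; case.
have [h ho he] := IH (fun i => e (lift ord_max i)).
pose w := e ord_max - \sum_j inner (e ord_max) (h j) *: h j.
have wh j : inner w (h j) = 0.
  rewrite innerBl inner_suml (bigD1 j)//= big1 ?addr0 => [|i ij].
    rewrite innerZl ho eqxx/=; have [->|_] := eqVneq (h j) 0.
      by rewrite inner0r mul0r subrr.
    by rewrite mulr1 subrr.
  by rewrite innerZl ho (negbTE ij) mulr0.
(* If [w = 0], then [hw = 0], a zero vector allowed in the family. *)
pose hw := (`|w|)^-1 *: w.
have hwh j : inner hw (h j) = 0 by rewrite innerZl wh mulr0.
have hhw j : inner (h j) hw = 0 by rewrite innerC hwh rmorph0.
have hw1 : w != 0 -> inner hw hw = 1.
  move=> w0; have w0' : `|w| != 0 by rewrite normr_eq0.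
  by rewrite innerZl innerZr -sqr_norm fmorphV/= geC0_conj// expr2 mulKf// mulVf.
have hw0 : (hw == 0) = (w == 0).
  by rewrite scaler_eq0 invr_eq0 normr_eq0 orbb.
have eE : e ord_max = \sum_j inner (e ord_max) (h j) *: h j +
                      inner (e ord_max) hw *: hw.
  rewrite -[LHS](subrK (\sum_j inner (e ord_max) (h j) *: h j)) -/w addrC.
  congr (_ + _); have [w0|w0] := eqVneq w 0.
    by rewrite /hw w0 scaler0 scaler0.
  have -> : inner (e ord_max) hw = `|w|.
    rewrite -[e ord_max](subrK (\sum_j inner (e ord_max) (h j) *: h j)) -/w.
    rewrite innerDl inner_suml big1 ?addr0 => [|j _]; last first.
      by rewrite innerZl hhw mulr0.
    by rewrite innerZr -sqr_norm fmorphV/= geC0_conj// expr2 mulKf ?normr_eq0.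
  by rewrite scalerA divff ?scale1r// normr_eq0.
exists (fun i => if unlift ord_max i is Some j then h j else hw) => [i j|i].
  case: (unliftP ord_max i) => [i'|] ->; case: (unliftP ord_max j) => [j'|] ->.
  - by rewrite ho (inj_eq lift_inj).
  - by rewrite hhw eq_sym (negbTE (neq_lift _ _)).
  - by rewrite hwh (negbTE (neq_lift _ _)).
  - rewrite eqxx hw0/=; have [w0|/hw1//] := eqVneq w 0.
    by rewrite /hw w0 scaler0 inner0l.
rewrite big_ord_recr/= unlift_none.
have lmax (j : 'I_k) : widen_ord (leqnSn k) j = lift ord_max j.
  by apply: val_inj; rewrite /= /bump leqNgt ltn_ord.
under eq_bigr do rewrite lmax liftK.
case: (unliftP ord_max i) => [i'|] ->; last exact: eE.
have -> : inner (e (lift ord_max i')) hw = 0.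
  by rewrite he inner_suml big1// => j _; rewrite innerZl hhw mulr0.
by rewrite scale0r addr0.
Qed.

(* Expanding [F (f i)] along an orthonormal basis [h] of the range of [F], the
   sum becomes one of [k] terms [\sum_i <F f_i, h_j> <h_j, g_i>], each bounded
   by Cauchy-Schwarz and Bessel's inequality for [f] and [g]. *)
Lemma trace_rank_le (I : finType) (f g : I -> K) (k : nat)
    (F : {linear K -> K}) (C : R[i]) :
  orthonormal_family f -> orthonormal_family g ->
  0 <= C -> (forall v, `|F v| <= C * `|v|) -> rank_le k F ->
  `|\sum_i inner (F (f i)) (g i)| <= k%:R * C.
Proof.
move=> fo go C0 FC /rank_le_basis[h [h1 hF]].
have -> : \sum_i inner (F (f i)) (g i) =
    \sum_j \sum_i inner (F (f i)) (h j) * inner (h j) (g i).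
  rewrite exchange_big/=; apply: eq_bigr => i _; rewrite {1}hF inner_suml.
  by apply: eq_bigr => j _; rewrite innerZl.
apply: (le_trans (ler_norm_sum _ _ _)).
rewrite -[k in k%:R](card_ord k) mulr_natl -sumr_const; apply: ler_sum => j _.
pose u := \sum_i inner (F (f i)) (h j) *: g i.
have u2 : `|u| <= C.
  rewrite -(@ler_pXn2r _ 2)// ?nnegrE// sqr_norm_orthonormal_sum//.
  exact: Bessel_map.
have -> : \sum_i inner (F (f i)) (h j) * inner (h j) (g i) =
    inner u (\sum_i inner (g i) (h j) *: g i).
  rewrite inner_orthonormal_sum2//; apply: eq_bigr => i _.
  by rewrite -[in RHS]innerC.
apply: (le_trans (CauchySchwarz_inner _ _)).
rewrite -[leRHS]mulr1 ler_pM// -(@expr_le1 _ 2)// sqr_norm_orthonormal_sum//.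
apply: (@le_trans _ _ (`|h j| ^+ 2)); last by rewrite exprn_ile1.
apply: le_trans (Bessel go (h j)); apply: ler_sum => i _.
by rewrite innerC norm_conjC.
Qed.

End hilbert.

(** * Singular values *)

Section singular_values.
Variables (R : realType) (K : hilbertType R).
Implicit Types T F : {linear K -> K}.

Lemma continuous_linear_bound T : continuous T ->
  exists2 C : R[i], 0 <= C & forall v, `|T v| <= C * `|v|.
Proof.
move=> /linear_bounded_continuous/linear_boundedP/pinfty_ex_gt0[C C0 TC].
by exists C => //; exact: ltW.
Qed.

Lemma opnorm_has_ubound T : continuous T ->
  has_ubound [set complex.Re `|T v| | v in [set v : K | `|v| <= 1]].
Proof.
move=> /continuous_linear_bound[C C0 TC]; exists (complex.Re C) => _ [v /= v1 <-].
have : `|T v| <= C by rewrite (le_trans (TC v))// ler_piMr.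
by rewrite lecE => /andP[].
Qed.

Lemma opnorm_ge0 T : continuous T -> 0 <= opnorm T.
Proof.
move=> Tc; apply: ub_le_sup; first exact: opnorm_has_ubound.
by exists 0; rewrite /= ?linear0 ?normr0.
Qed.

Lemma opnorm_le T v : continuous T -> `|T v| <= (opnorm T)%:C * `|v|.
Proof.
move=> Tc; have [->|v0] := eqVneq v 0; first by rewrite linear0 !normr0 mulr0.
rewrite -ler_pdivrMr ?normr_gt0//.
have -> : `|T v| / `|v| = `|T (`|v|^-1 *: v)|.
  by rewrite linearZ/= normrZ normfV normr_id mulrC.
set w := _ *: v; rewrite -(RRe_real (normr_real (T w))) lecR.
apply: ub_le_sup; first exact: opnorm_has_ubound.
exists w => //=; rewrite /w normrZ normfV normr_id mulVf// normr_eq0//.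
Qed.

Let approx T k := [set opnorm (fun v => T v - F v)
      | F in [set F : {linear K -> K} | continuous F /\ rank_le k F]].

Let opnormB_ge0 T F : continuous T -> continuous F ->
  0 <= opnorm (fun v => T v - F v).
Proof.
move=> Tc Fc; apply: (@opnorm_ge0 (T \- F)).
by move=> v; apply: continuousB; [exact: Tc|exact: Fc].
Qed.

Let approx_neq0 T k : approx T k !=set0.
Proof.
exists (opnorm (fun v => T v - (\0 : {linear K -> K}) v)).
exists (\0 : {linear K -> K}) => //=; split; first exact: cst_continuous.
by exists (fun=> 0) => v; exists (fun=> 0); rewrite big1// => i _; rewrite scaler0.
Qed.

Let approx_lb T k : continuous T -> lbound (approx T k) 0.
Proof. by move=> Tc _ [F [Fc _] <-]; exact: opnormB_ge0. Qed.

Lemma singular_value_ge0 T k : continuous T -> 0 <= singular_value T k.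
Proof. by move=> Tc; apply: lb_le_inf; [exact: approx_neq0|exact: approx_lb]. Qed.

Lemma rank_leW (m n : nat) (F : K -> K) : (m <= n)%N -> rank_le m F -> rank_le n F.
Proof.
move=> mn [e Fe]; rewrite -(subnKC mn).
exists (fun i : 'I_(m + (n - m)) => if fintype.split i is inl j then e j else 0) => v.
have [c ->] := Fe v.
exists (fun i : 'I_(m + (n - m)) => if fintype.split i is inl j then c j else 0).
rewrite big_split_ord/= [X in _ + X]big1 ?addr0 => [|i _].
  by apply: eq_bigr => i _; rewrite (unsplitK (inl i)).
by rewrite (unsplitK (inr i)) scale0r.
Qed.

Lemma singular_value_nincr T (m n : nat) : continuous T -> (m <= n)%N ->
  singular_value T n <= singular_value T m.
Proof.
move=> Tc mn; apply: lb_le_inf => [|_ [F [Fc Fm] <-]]; first exact: approx_neq0.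
apply: ge_inf; first by exists 0; exact: approx_lb.
by exists F => //; split=> //; exact: rank_leW Fm.
Qed.

Lemma singular_value_lt T k (e : R) : continuous T -> singular_value T k < e ->
  exists F : {linear K -> K},
    [/\ continuous F, rank_le k F & forall v, `|T v - F v| <= e%:C * `|v|].
Proof.
move=> Tc Te; have [||] := @inf_adherent _ (approx T k) (e - singular_value T k).
- by rewrite subr_gt0.
- by split; [exact: approx_neq0|exists 0; exact: approx_lb].
move=> _ [F [Fc Fk] <-]; rewrite -/(singular_value T k) addrC subrK => TFe.
exists F; split=> // v; have /= := @opnorm_le (T \- F) v.
have TFc : continuous (T \- F).
  by move=> w; apply: continuousB; [exact: Tc|exact: Fc].
move=> /(_ TFc)/le_trans; apply.
by rewrite ler_wpM2r// lecR ltW.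
Qed.

(** As [s_k] is nonincreasing and [s_k^p] is summable, [m s_m^p] tends to [0]. Once [s_m <= 1],
    [p <= d] gives [m s_m^d <= m s_m^p], and [m = 2^(jd)] is a [d]-th power. *)
Lemma schatten_decay T (p : R) (d : nat) (e : R) :
  continuous T -> schatten p T -> 0 < p <= d%:R -> 0 < e ->
  exists j0, forall j, (j0 <= j)%N -> singular_value T (2 ^ (j * d)) < e / 2 ^+ j.
Proof.
move=> Tc [_ sfin] /andP[p0 pd] e0; set s := singular_value T in sfin *.
have s0 k : 0 <= s k by exact: singular_value_ge0.
have d0 : (0 < d)%N by rewrite -(ltr0n R) (lt_le_trans p0).
(* The bound by [1] forces [s_m <= 1], the bound by [e^d] gives the conclusion, and the factor [4]
   leaves both strict after doubling [eta]. *)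
pose mu : R := Num.min 1 (e ^+ d); pose eta := mu / 4.
have mu0 : 0 < mu by rewrite lt_min ltr01 exprn_gt0.
have [mu1 mue] : mu <= 1 /\ mu <= e ^+ d by rewrite !ge_min !lexx orbT.
have eta0 : 0 < eta by rewrite divr_gt0.
have [tfin /cvgrPdist_lt/(_ _ eta0) tlt] := proj1 (fine_cvgP _ _)
  (nneseries_tail_cvg sfin (fun k _ => powR_ge0 _ _ : (0 <= (s k `^ p)%:E)%E)).
have [N _ tN] := filterI tfin tlt; have {tfin tlt tN} [tfin tlt] := tN N (leqnn N).
(* Each of the [m - N] terms from [N] up to [m] is at least [s_m^p], and their sum is at most the
   tail from [N]. *)
have tail m : (N <= m)%N -> (m - N)%:R * s m `^ p <= eta.
  move=> Nm; rewrite -lee_fin; apply: (@le_trans _ _ (\sum_(N <= k < m) (s k `^ p)%:E)%E).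
    rewrite sumEFin lee_fin mulr_natl -sumr_const_nat; apply: ler_sum_nat => k /andP[_ km].
    apply: ge0_ler_powR; rewrite ?nnegrE ?s0 ?(ltW p0)//.
    exact: singular_value_nincr (ltnW km).
  apply: le_trans (nneseries_lim_ge _ (fun k _ _ => _)) _ => [k|]; first by rewrite lee_fin powR_ge0.
  rewrite -(fineK tfin) lee_fin; move: tlt => /=; rewrite sub0r normrN => /ltW.
  by apply: le_trans; rewrite ler_norm.
(* This makes [m >= 2 N], so that [m <= 2 (m - N)]: losing the first [N] terms costs a factor
   [2]. *)
exists (2 * N).+1 => j Nj; pose m := (2 ^ (j * d))%N.
have jm : (2 * N <= m)%N.
  rewrite (leq_trans (ltnW Nj))// (leq_trans (ltnW (ltn_expl j (ltnSn 1))))//.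
  by rewrite leq_exp2l// leq_pmulr.
have m0 : (0 < m)%N by rewrite expn_gt0.
have msm : m%:R * s m `^ p <= 2 * eta.
  have Nm : (N <= m)%N by rewrite (leq_trans _ jm)// leq_pmull.
  have := tail m Nm; rewrite natrB//; have := powR_ge0 (s m) p.
  have : 2 * N%:R <= m%:R :> R by rewrite -natrM ler_nat.
  move: (_ `^ _) (m%:R) (N%:R) => a b c; nra.
have [eta1 etae] : 2 * eta < 1 /\ 2 * eta < e ^+ d by rewrite /eta; split; lra.
rewrite ltr_pdivlMr ?exprn_gt0//.
have sm_p : s m `^ p <= 2 * eta.
  by apply: le_trans msm; rewrite ler_peMl ?powR_ge0// ler1n.
have sm1 : s m <= 1.
  rewrite leNgt; apply/negP => sm1; have : 1 < s m `^ p.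
    by have := gt0_ltr_powR p0 _ _ sm1; rewrite powR1; apply; rewrite nnegrE.
  by lra.
have [sm0|sm0] := eqVneq (s m) 0; first by rewrite sm0 mul0r.
rewrite -(@ltr_pXn2r _ d)// ?nnegrE ?mulr_ge0 ?exprn_ge0 ?(ltW e0)//.
rewrite exprMn -exprM; apply: le_lt_trans etae; apply: le_trans msm.
rewrite mulrC /m natrX ler_wpM2l ?exprn_ge0// -powR_mulrn//.
by rewrite ger_powR// lt_neqAle eq_sym sm0 s0.
Qed.

End singular_values.

(** * Sums of diagonal coefficients over growing families *)

Section trace_asymptotics.
Variables (R : realType) (K : hilbertType R).
Implicit Types T F : {linear K -> K}.

Lemma rank_leB (m n : nat) (F G : K -> K) :
  rank_le m F -> rank_le n G -> rank_le (m + n) (fun v => F v - G v).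
Proof.
move=> [e Fe] [f Gf].
exists (fun i => match fintype.split i with inl j => e j | inr j => - f j end) => v.
have [c ->] := Fe v; have [c' ->] := Gf v.
exists (fun i => match fintype.split i with inl j => c j | inr j => c' j end).
rewrite big_split_ord/= -sumrN; congr (_ + _).
  by apply: eq_bigr => i _; rewrite (unsplitK (inl i)).
by apply: eq_bigr => i _; rewrite (unsplitK (inr i)) scalerN.
Qed.

(** For the remainder [T - F_J], which has no rank bound: Cauchy-Schwarz bounds each coefficient by
    [c]. *)
Lemma trace_card_le (I : finType) (f g : I -> K) T (c : R) :
  orthonormal_family f -> orthonormal_family g ->
  (forall v, `|T v| <= c%:C * `|v|) ->
  `|\sum_i inner (T (f i)) (g i)| <= (#|I|%:R * c)%:C.
Proof.
move=> fo go Tc; apply: (le_trans (ler_norm_sum _ _ _)).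
rewrite rmorphM rmorph_nat -sum1_card natr_sum mulr_suml.
apply: ler_sum => i _; apply: (le_trans (CauchySchwarz_inner _ _)).
have n1 (h : I -> K) : orthonormal_family h -> `|h i| = 1.
  by move=> ho; rewrite normEinner ho eqxx sqrtC1.
by rewrite (n1 g)// mulr1 mul1r (le_trans (Tc _))// (n1 f)// mulr1.
Qed.

(* [T] is approximated by [F_j] of rank [2^(jd)] within [e 2^-j]; in
   [T = F_j0 + \sum_(j0 <= j < J) (F_(j+1) - F_j) + (T - F_J)] the trace bounds
   [rank * norm] form a geometric series of ratio [2^(d-1) >= 2]. *)
Lemma trace_little_o T (p : R) (d : nat) (e : R) :
  (2 <= d)%N -> continuous T -> schatten p T -> 0 < p <= d%:R -> 0 < e ->
  exists J0, forall J, (J0 <= J)%N ->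
    forall (I : finType) (f g : I -> K), #|I| = (2 ^ (J * d))%N ->
    orthonormal_family f -> orthonormal_family g ->
    `|\sum_i inner (T (f i)) (g i)| <= (e * (2 ^+ J) ^+ d.-1)%:C.
Proof.
(* The telescoped part costs [9 e1] and the remainder [e1], in total [e / 2]; the other half absorbs
   the constant [c0] of the first approximant. *)
move=> d2 Tc Tp pd e0; pose e1 := e / 20.
have e10 : 0 < e1 by rewrite divr_gt0.
have [j0 j0P] := schatten_decay Tc Tp pd e10.
have /choice[F FP] : forall j, exists F : {linear K -> K}, (j0 <= j)%N ->
    [/\ continuous F, rank_le (2 ^ (j * d)) F
      & forall v, `|T v - F v| <= (e1 / 2 ^+ j)%:C * `|v|].
  (* Below [j0] nothing is required of [F j], and [T] serves as a default. *)
  move=> j; have [jj|] := leqP j0 j; last by exists T.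
  by have [F FP] := singular_value_lt Tc (j0P j jj); exists F.
have powE J : (2 ^ (J * d))%N%:R = (2 ^+ J) ^+ d.-1 * 2 ^+ J :> R.
  by rewrite natrX exprM -exprSr prednK// ltnW.
pose c0 := (2 ^ (j0 * d))%N%:R * opnorm (F j0).
have e_ge0 m : 0 <= e1 / 2 ^+ m by rewrite divr_ge0 ?exprn_ge0// ltW.
have step (J : nat) (I : finType) (f g : I -> K) : (j0 <= J)%N ->
    orthonormal_family f -> orthonormal_family g ->
    `|\sum_i inner (F J (f i)) (g i)| <= (c0 + 9 * e1 * (2 ^+ J) ^+ d.-1)%:C.
  move=> jJ fo go; rewrite -(subnK jJ); elim: (J - j0)%N => [|n IH].
    have [Fc Fr _] := FP j0 (leqnn _).
    have := trace_rank_le fo go _ (fun v => opnorm_le v Fc) Fr.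
    rewrite ler0c opnorm_ge0// => /(_ isT)/le_trans; apply.
    rewrite -(rmorph_nat (real_complex R)) -rmorphM lecR lerDl.
    by rewrite !mulr_ge0// ?exprn_ge0// ltW.
  rewrite addSn; set m := (n + j0)%N in IH *.
  have [Fc Fr FT] := FP m (leq_addl _ _).
  have [Gc Gr GT] := FP m.+1 (leqW (leq_addl _ _)).
  have GF v : `|F m.+1 v - F m v| <= (e1 / 2 ^+ m + e1 / 2 ^+ m.+1)%:C * `|v|.
    rewrite rmorphD mulrDl -(subrKA (T v)) addrC.
    by rewrite (le_trans (ler_normD _ _))// lerD// distrC.
  have := trace_rank_le (F := F m.+1 \- F m) fo go _ GF (rank_leB Gr Fr).
  rewrite ler0c addr_ge0 ?e_ge0// => /(_ isT) GFle.
  have -> : \sum_i inner (F m.+1 (f i)) (g i) =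
      \sum_i inner (F m (f i)) (g i) + \sum_i inner ((F m.+1 \- F m) (f i)) (g i).
    by rewrite -big_split; apply: eq_bigr => i _ /=; rewrite -innerDl addrC subrK.
  apply: (le_trans (ler_normD _ _)); apply: (le_trans (lerD IH GFle)).
  rewrite -(rmorph_nat (real_complex R)) -rmorphM -rmorphD lecR -addrA lerD2l natrD !powE.
  have -> : (2 ^+ m.+1) ^+ d.-1 = 2 ^+ d.-1 * (2 ^+ m) ^+ d.-1 :> R.
    by rewrite exprS exprMn.
  have D2 : 2 <= 2 ^+ d.-1 :> R by rewrite ler_eXnr// ?ler1n// -subn1 subn_gt0.
  have q0 : 0 <= (2 ^+ m) ^+ d.-1 :> R by rewrite !exprn_ge0.
  have x0 : 0 < 2 ^+ m :> R by rewrite exprn_gt0.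
  rewrite exprS; move: (2 ^+ d.-1) D2 => D D2; move: ((2 ^+ m) ^+ d.-1) q0 => q q0.
  move: (2 ^+ m) x0 => x x0.
  have -> : (D * q * (2 * x) + q * x) * (e1 / x + e1 / (2 * x)) =
            q * e1 * ((2 * D + 1) * 3 / 2) by field; rewrite gt_eqF.
  (* The induction closes by [9 + (2 D + 1) * 3 / 2 <= 9 D], true as [D = 2^(d-1) >= 2]; this uses
     [d >= 2]. *)
  have rE : 0 <= q * e1 by rewrite mulr_ge0// ltW.
  have -> : 9 * e1 * q = q * e1 * 9 by ring.
  have -> : 9 * e1 * (D * q) = q * e1 * (9 * D) by ring.
  rewrite -mulrDr ler_wpM2l//; lra.
(* From [J1] on the constant is absorbed, as [J1 <= 2^J <= (2^J)^(d-1)]. *)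
have [J1 J1P] : exists J1 : nat, c0 <= e / 2 * J1%:R.
  exists (Num.truncn (c0 / (e / 2))).+1.
  by rewrite mulrC -ler_pdivrMr ?divr_gt0// ltW// truncnS_gt.
exists (maxn j0 J1) => J; rewrite geq_max => /andP[jJ J1J] I f g cI fo go.
have [Fc Fr FT] := FP J jJ.
have := trace_card_le (T := T \- F J) fo go FT; rewrite cI => TF.
have -> : \sum_i inner (T (f i)) (g i) =
    \sum_i inner (F J (f i)) (g i) + \sum_i inner ((T \- F J) (f i)) (g i).
  by rewrite -big_split; apply: eq_bigr => i _ /=; rewrite -innerDl addrC subrK.
apply: (le_trans (ler_normD _ _)); apply: (le_trans (lerD (step J _ _ _ jJ fo go) TF)).
rewrite -rmorphD lecR powE.
have x0 : 0 < 2 ^+ J :> R by rewrite exprn_gt0.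
have xq : 2 ^+ J <= (2 ^+ J) ^+ d.-1 :> R.
  by rewrite ler_eXnr// ?exprn_ege1// ?ler1n// -subn1 subn_gt0.
have Jx : J1%:R <= 2 ^+ J :> R.
  by rewrite -natrX ler_nat (leq_trans J1J)// ltnW// ltn_expl.
have -> : (2 ^+ J) ^+ d.-1 * 2 ^+ J * (e1 / 2 ^+ J) = e1 * (2 ^+ J) ^+ d.-1.
  by field; rewrite gt_eqF.
rewrite /e1; move: ((2 ^+ J) ^+ d.-1) xq => q xq.
have : e / 2 * J1%:R <= e / 2 * q by rewrite ler_wpM2l ?divr_ge0 ?(ltW e0)// (le_trans Jx).
lra.
Qed.

End trace_asymptotics.

(** * Summation along an orthonormal family *)

Section orthonormal_series.
Variables (R : realType) (K : hilbertType R).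

Lemma cvg_innerl (T : Type) (F : set_system T) {FF : Filter F} (u : T -> K) (l v : K) :
  u @ F --> l -> inner (u t) v @[t --> F] --> inner l v.
Proof.
move=> /cvgrPdist_lt ul; apply/cvgrPdist_lt => e e0.
have c0 : 0 < `|v| + 1 by rewrite ltr_wpDl.
have := ul _ (divr_gt0 e0 c0); apply: filterS => t ult.
rewrite -innerBl (le_lt_trans (CauchySchwarz_inner _ _))//.
rewrite (@le_lt_trans _ _ (`|l - u t| * (`|v| + 1)))//.
  by rewrite ler_wpM2l// lerDl.
by rewrite -ltr_pdivlMr.
Qed.

Variables (I : choiceType) (e : I -> K) (c : I -> R[i]) (y : K).
Hypotheses (e_on : orthonormal_family e) (c_le : forall i, `|c i| <= `|inner y (e i)|).

(** The squared norms of the partial sums, real-valued so that [sup] applies. They increase with [A]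
    and stay below [|y|^2] by Bessel's inequality, the [c i] being dominated by the coefficients of
    [y]. *)
Let g (A : {fset I}) : R := \sum_(i <- A) complex.Re (`|c i| ^+ 2).

Let gE (A : {fset I}) : (g A)%:C = `|summability.partial_sum (fun i => c i *: e i) A| ^+ 2.
Proof.
rewrite (sqr_norm_orthonormal_sum (f := fun i : A => e (val i))); last first.
  exact: orthonormal_comp val_inj e_on.
rewrite /g big_seq_fsetE rmorph_sum; apply: eq_bigr => i _.
by apply: RRe_real; rewrite rpredX// normr_real.
Qed.

Let g_le A : (g A)%:C <= `|y| ^+ 2.
Proof.
have h : orthonormal_family (fun i : A => e (val i)) by exact: orthonormal_comp val_inj e_on.
rewrite gE (sqr_norm_orthonormal_sum (f := fun i : A => e (val i)))//.
apply: le_trans (Bessel h y); apply: ler_sum => i _.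
by rewrite lerXn2r.
Qed.

Let gB (A B : {fset I}) : (A `<=` B)%fset ->
  `|summability.partial_sum (fun i => c i *: e i) B -
    summability.partial_sum (fun i => c i *: e i) A| ^+ 2 = (g B - g A)%:C.
Proof.
move=> AB; pose D := [fset x in B | x \notin A]%fset.
have BE (V : zmodType) (F : I -> V) : \sum_(i <- B) F i = \sum_(i <- A) F i + \sum_(i <- D) F i.
  rewrite (big_fsetID _ (fun i => i \in A)); congr (_ + _).
  by apply: eq_fbigl => i; rewrite !inE andbC; apply/andb_idr => /(fsubsetP AB).
have psE (A' : {fset I}) : summability.partial_sum (fun i => c i *: e i) A' =
    \sum_(i <- A') c i *: e i by rewrite [RHS]big_seq_fsetE.
by rewrite {1}psE BE -psE addrC addKr -psE -gE /g BE addrC addKr.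
Qed.

(** The squared distance of nested partial sums is the increment of [g]; beyond a set [A0] almost
    reaching the supremum of [g], all partial sums are close to that of [A0]. *)
Lemma orthonormal_series_cvg :
  cvg (summability.partial_sum (fun i => c i *: e i) @ summability.totally).
Proof.
have FF := @summability.totally_filter I.
set ps := summability.partial_sum _.
have g_has_sup : has_sup (range g).
  split; first by exists (g fset0); exists fset0.
  exists (complex.Re (`|y| ^+ 2)) => _ [A _ <-].
  by have := g_le A; rewrite lecE => /andP[].
apply/cauchy_cvgP/cauchy_ballP => eps eps0; pose r := complex.Re eps / 2.
have epsE : eps = (complex.Re eps)%:C by rewrite RRe_real// gtr0_real.
have r0 : 0 < r by rewrite divr_gt0// -(@ltcR R) -epsE; exact: eps0.
have [_ [A0 _ <-]] := sup_adherent (exprn_gt0 2 r0) g_has_sup => gA0.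
have near_A0 B : (A0 `<=` B)%fset -> `|ps B - ps A0| < r%:C.
  move=> AB; rewrite -(@ltr_pXn2r _ 2)// ?nnegrE ?ler0c ?(ltW r0)// gB// -rmorphXn/= ltcR.
  have : g B <= sup (range g) by apply: ub_le_sup; [case: g_has_sup|exists B].
  lra.
pose S := [set B | (A0 `<=` B)%fset].
have FS : summability.totally S by exists A0.
exists (ps @` S, ps @` S) => /=.
  by split; apply: filterS FS => B SB; exists B.
move=> [_ _] /= [[B SB <-] [B' SB' <-]].
rewrite -ball_normE /= -[ps B](subrK (ps A0)) -addrA (le_lt_trans (ler_normD _ _))//.
rewrite [ltRHS]epsE [complex.Re _](splitr) rmorphD/= ltrD ?near_A0//.
by rewrite distrC near_A0.
Qed.

(** Once [j] belongs to the finite set, the coefficient of the partial sum at [e j] no longer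
    changes. *)
Lemma inner_orthonormal_series j :
  inner (summability.sum (fun i => c i *: e i)) (e j) = c j.
Proof.
have FF := @summability.totally_filter I.
have /(_ _) cl := cvg_innerl (v := e j) orthonormal_series_cvg.
rewrite -(cvg_lim (@norm_hausdorff _ _) cl); apply: cvg_lim; first exact: norm_hausdorff.
apply: cvg_near_cst; exists [fset j]%fset => // B; rewrite /= fsub1set => jB.
rewrite (inner_orthonormal_sum (f := fun i : B => e (val i)) _ (c \o val) [` jB]%fset)//.
Qed.

End orthonormal_series.

(** * Monomials in the quantum torus *)

Section phases.
Variables (R : realType) (A : cstarType R).
Implicit Types (a b c u : A) (w : R[i]).

Lemma star1 : star (1 : A) = 1.
Proof. by have := starM (star 1) (1 : A); rewrite !mulr1 !starK mulr1 => <-. Qed.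

Lemma starB a b : star (a - b) = star a - star b.
Proof. by rewrite starD -scaleN1r starZ rmorphN1 scaleN1r. Qed.

Lemma cnorm_ge0 a : 0 <= cnorm a.
Proof.
have := cnormD a (- a); rewrite subrr -scaleN1r cnormZ normrN1 mul1r.
rewrite -(scale0r a) cnormZ normr0 mul0r -mulr2n => h.
by rewrite -(@pmulrn_lge0 _ _ 2).
Qed.

(** The norm of [star b * b] is [|b|^2], so that [|b| <= |star b|]; applying this to [star b] as
    well gives equality. *)
Lemma cnorm_starE a : cnorm (star a) = cnorm a.
Proof.
have le b : cnorm b <= cnorm (star b).
  have [b0|b0] := eqVneq (cnorm b) 0; first by rewrite b0 cnorm_ge0.
  have bp : 0 < cnorm b by rewrite lt_neqAle eq_sym b0 cnorm_ge0.
  by rewrite -(ler_pM2r bp) -expr2 -cnorm_star cnormM.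
by apply/eqP; rewrite eq_le le -{2}(starK a) le.
Qed.

Lemma unitary1 : unitary (1 : A).
Proof. by rewrite /unitary star1 mulr1. Qed.

Lemma unitaryM u a : unitary u -> unitary a -> unitary (u * a).
Proof.
move=> [u1 u2] [a1 a2]; split; rewrite starM mulrA.
  by rewrite -(mulrA (star a)) u1 mulr1.
by rewrite -(mulrA u) a2 mulr1.
Qed.

Lemma unitary_star u : unitary u -> unitary (star u).
Proof. by move=> [u1 u2]; split; rewrite starK. Qed.

Lemma unitaryX u k : unitary u -> unitary (u ^+ k).
Proof.
by move=> uu; elim: k => [|k IH]; [exact: unitary1|rewrite exprS; exact: unitaryM].
Qed.

Lemma unitary_upow u m : unitary u -> unitary (upow u m).
Proof.
by case: m => m uu; rewrite /upow; apply: unitaryX => //; exact: unitary_star.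
Qed.

Lemma upowS u m : unitary u -> upow u (1 + m) = u * upow u m.
Proof.
move=> [_ u2]; case: m => [m|[|m]].
- by rewrite -PoszD add1n/= exprS.
- by rewrite NegzE subrr/= expr1 u2.
- have -> : 1 + Negz m.+1 = Negz m by rewrite !NegzE; lia.
  by rewrite /upow [in RHS]exprS mulrA u2 mul1r.
Qed.

Lemma upowD u (m n : int) : unitary u -> upow u (m + n) = upow u m * upow u n.
Proof.
move=> uu; elim: m n => [n|m IH n|m IH n].
- by rewrite add0r mul1r.
- by rewrite (_ : m.+1%:Z + n = 1 + (m%:Z + n)) ?upowS ?IH ?mulrA -?upowS//; lia.
have inj a b : u * a = u * b -> a = b.
  by move=> ab; rewrite -[a]mul1r -(proj1 uu) -mulrA ab mulrA (proj1 uu) mul1r.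
apply: inj; rewrite mulrA -!upowS// (_ : 1 + - m.+1%:Z = - m%:Z); last by lia.
by rewrite -IH; congr upow; lia.
Qed.

(** The commutation relations are used only up to such scalars: the values of the phases never
    matter, since they are rotated away in the final sums. *)
Definition phase_eq a b := exists2 w, `|w| = 1 & a = w *: b.

Lemma phase_refl a : phase_eq a a.
Proof. by exists 1; rewrite ?normr1 ?scale1r. Qed.

Lemma phase_sym a b : phase_eq a b -> phase_eq b a.
Proof.
move=> [w w1 ->]; exists w^-1; first by rewrite normfV w1 invr1.
by rewrite scalerA mulVf ?scale1r// -normr_gt0 w1.
Qed.

Lemma phase_trans a b c : phase_eq a b -> phase_eq b c -> phase_eq a c.
Proof.
move=> [w w1 ->] [z z1 ->]; exists (w * z); first by rewrite normrM w1 z1 mulr1.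
by rewrite scalerA.
Qed.

Lemma phaseM a a' b b' : phase_eq a a' -> phase_eq b b' -> phase_eq (a * b) (a' * b').
Proof.
move=> [w w1 ->] [z z1 ->]; exists (w * z); first by rewrite normrM w1 z1 mulr1.
by rewrite -scalerAl -scalerAr scalerA.
Qed.

Definition phase_comm a b := phase_eq (a * b) (b * a).

Lemma phase_commC a b : phase_comm a b -> phase_comm b a.
Proof. exact: phase_sym. Qed.

Lemma phase_comm1 a : phase_comm a 1.
Proof. by rewrite /phase_comm mul1r mulr1; exact: phase_refl. Qed.

Lemma phase_commM a b c : phase_comm a b -> phase_comm a c -> phase_comm a (b * c).
Proof.
move=> ab ac; rewrite /phase_comm mulrA -[b * c * a]mulrA.
apply: (@phase_trans _ (b * a * c)); first exact: phaseM (phase_refl _).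
by rewrite -mulrA; apply: phaseM => //; exact: phase_refl.
Qed.

Lemma phase_comm_upow a u m : unitary u -> phase_comm a u -> phase_comm a (upow u m).
Proof.
move=> [u1 u2] au.
(* With [v = star u], [a v = v (u a) v], which up to a phase is [v (a u) v = v a]. *)
have au' : phase_comm a (star u).
  apply: phase_sym; rewrite -[star u * a]mulr1 -u2 !mulrA -(mulrA _ a).
  have -> : a * star u = star u * (u * a) * star u by rewrite mulrA u1 mul1r.
  by apply: phaseM; [apply: phaseM => //|]; exact: phase_refl.
case: m => m; rewrite /upow.
  by elim: m => [|m IH]; [exact: phase_comm1|rewrite exprS; exact: phase_commM].
by elim: m.+1 => [|k IH]; [exact: phase_comm1|rewrite exprS; exact: phase_commM].
Qed.

(** Induction on [r]: the head factor [y i] is moved past all the [x j] of the tail. *)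
Lemma phase_prod (I : eqType) (r : seq I) (x y : I -> A) :
  (forall i j, phase_comm (y i) (x j)) ->
  phase_eq (\prod_(i <- r) x i * \prod_(i <- r) y i) (\prod_(i <- r) (x i * y i)).
Proof.
move=> yx; elim: r => [|i r IH]; first by rewrite !big_nil mulr1; exact: phase_refl.
rewrite !big_cons.
have yX : phase_comm (y i) (\prod_(j <- r) x j).
  by elim/big_ind: _ => //; [exact: phase_comm1|exact: phase_commM].
apply: (@phase_trans _ (x i * y i * (\prod_(j <- r) x j * \prod_(j <- r) y j))).
  rewrite -!mulrA; apply: phaseM; first exact: phase_refl.
  by rewrite !mulrA; apply: phaseM; [exact: phase_sym|exact: phase_refl].
by apply: phaseM => //; exact: phase_refl.
Qed.

End phases.

(** * Orthonormality of the monomials; coefficients of products and multipliers *)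

Section torus_basis.
Variables (R : realType) (d : nat) (theta : 'M[R]_d) (X : quantumTorus theta).
Implicit Types (m n : 'rV[int]_d) (a b : CT X) (x y : L2 X).

Lemma norm_expi (t : R) : `|expi t| = 1 :> R[i].
Proof. by rewrite normc_def /= cos2Dsin2 sqrtr1. Qed.

Lemma gen_unitary j : unitary (@gen _ _ _ X j).
Proof. by have [+ _] := @gen_relations _ _ _ X. Qed.

Lemma gen_phase_comm j k : phase_comm (@gen _ _ _ X j) (@gen _ _ _ X k).
Proof.
have [_ /(_ j k) jk] := @gen_relations _ _ _ X.
by exists (expi (2 * pi * theta j k)); first exact: norm_expi.
Qed.

Lemma Umon_unitary n : unitary (Umon X n).
Proof.
rewrite /Umon /monomial; elim/big_ind: _ => [||j _]; first exact: unitary1.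
- by move=> ? ? ? ?; exact: unitaryM.
- by apply: unitary_upow; exact: gen_unitary.
Qed.

Lemma UmonM m n : phase_eq (Umon X m * Umon X n) (Umon X (m + n)).
Proof.
rewrite /Umon /monomial; apply: phase_trans (phase_prod _ _) _ => [i j|].
  apply: phase_comm_upow; first exact: gen_unitary.
  apply: phase_commC; apply: phase_comm_upow; first exact: gen_unitary.
  exact: gen_phase_comm.
under [X in phase_eq _ X]eq_bigr do rewrite mxE (upowD _ _ (gen_unitary _)).
exact: phase_refl.
Qed.

Lemma Umon0 : Umon X 0 = 1.
Proof. by rewrite /Umon /monomial big1// => j _; rewrite mxE. Qed.

(** [star (U^n)] is the inverse of [U^n], and so is [U^(-n)] up to a phase. *)
Lemma star_Umon n : phase_eq (star (Umon X n)) (Umon X (- n)).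
Proof.
rewrite -[star _]mulr1 -Umon0 -(subrr n).
apply: (@phase_trans _ _ _ (star (Umon X n) * (Umon X n * Umon X (- n)))).
  by apply: phaseM; [exact: phase_refl|exact/phase_sym/UmonM].
by rewrite mulrA (proj1 (Umon_unitary n)) mul1r; exact: phase_refl.
Qed.

Definition Ubasis n : L2 X := Lambda X (Umon X n).

Lemma basis_orthonormal : orthonormal_family Ubasis.
Proof.
move=> n m; rewrite inner_Lambda.
have [<-|nm] := eqVneq n m.
  by rewrite (proj1 (Umon_unitary n)); have [_ _ ->] := trace_state X.
have : phase_eq (star (Umon X m) * Umon X n) (Umon X (- m + n)).
  by apply: phase_trans (UmonM _ _); apply: phaseM; [exact: star_Umon|exact: phase_refl].
move=> [w _ ->]; rewrite linearZ/= trace_monomial addrC subr_eq0 (negbTE nm).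
by rewrite mulr0.
Qed.

Lemma sqr_norm_Lambda a : `|Lambda X a| ^+ 2 = trace X (star a * a).
Proof. by rewrite sqr_norm inner_Lambda. Qed.

(** By traciality. Right multiplication by [U^m] thus extends to all of [L_2], which makes [mulL2]
    meaningful on monomials. *)
Lemma norm_Lambda_unitary a b : unitary b -> `|Lambda X (a * b)| = `|Lambda X a|.
Proof.
move=> [_ b2]; apply/eqP; rewrite -(@eqrXn2 _ 2)//; apply/eqP.
by rewrite !sqr_norm_Lambda starM traceC !mulrA -(mulrA _ b) b2 mulr1 traceC.
Qed.

Lemma norm_Lambda_le a : `|Lambda X a| <= cnorm a.
Proof.
rewrite -(@ler_pXn2r _ 2)// ?nnegrE ?cnorm_ge0// sqr_norm_Lambda -cnorm_star.
have [_ h _] := trace_state X.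
by rewrite -[leLHS]ger0_norm ?h// -sqr_norm_Lambda exprn_ge0.
Qed.

(** The kernel of [Lambda] is a left ideal, so the product in [mulL2] does not depend on the
    representative [b]. *)
Lemma Lambda_mulr_eq a b b' : Lambda X b = Lambda X b' -> Lambda X (a * b) = Lambda X (a * b').
Proof.
move=> bb'; apply/eqP; rewrite -subr_eq0 -linearB -mulrBr/=; set c := b - b'.
have c0 : Lambda X c = 0 by rewrite linearB/= bb' subrr.
rewrite -normr_eq0 -sqrf_eq0 sqr_norm_Lambda starM -mulrA.
by rewrite -inner_Lambda c0 inner0r.
Qed.

Lemma Lambda_dense_seq x : exists a_ : nat -> CT X, (fun k => Lambda X (a_ k)) @ \oo --> x.
Proof.
have /choice[a_ aP] : forall k : nat, exists a, `|x - Lambda X a| < k.+1%:R^-1.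
  move=> k; have [||y [xy [a _ ay]]] := @Lambda_dense _ _ _ X (ball x (k.+1%:R^-1 : R[i])).
  - by exists x; apply: ballxx; rewrite invr_gt0.
  - by apply: ball_open; rewrite invr_gt0.
  by exists a; rewrite ay; move: xy; rewrite -ball_normE.
exists a_; apply/cvgrPdist_lt => e e0.
have er : e = (complex.Re e)%:C by rewrite RRe_real// gtr0_real.
have r0 : 0 < complex.Re e by rewrite -(@ltcR R) -er; exact: e0.
exists (Num.truncn (complex.Re e)^-1) => // k /= ke.
apply: lt_trans (aP k) _; rewrite er -(rmorph_nat (real_complex R)) -fmorphV ltcR.
rewrite -[ltRHS]invrK ltf_pV2 ?posrE ?invr_gt0//.
by rewrite (lt_le_trans (truncnS_gt _))// ler_nat.
Qed.

(** The [xget] in [mulL2] finds a limit because right multiplication by [U^m] is isometric; the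
    coefficient of any such limit follows by continuity from [trace (star (U^n) * a * U^m) = <a, U^n
    * star (U^m)>]. *)
Lemma mulL2_fourier x (c : R[i]) m n :
  inner (mulL2 x (c *: Ubasis m)) (Ubasis n) =
  c * inner x (Lambda X (Umon X n * star (Umon X m))).
Proof.
rewrite /mulL2; set P := (P in xget _ P).
have : P (xget 0 P).
  apply: xgetPex; have [a_ ax] := Lambda_dense_seq x.
  have : cvg ((fun k => Lambda X (a_ k * (c *: Umon X m))) @ \oo).
    apply/cauchy_cvgP/cauchy_ballP => e e0.
    have c0 : 0 < `|c| + 1 by rewrite ltr_wpDl.
    have e2 : 0 < e / (`|c| + 1) / 2 by rewrite !divr_gt0.
    move/cvgrPdist_lt : ax => /(_ _ e2)[N _ aN].
    exists ([set Lambda X (a_ k * (c *: Umon X m)) | k in [set k | (N <= k)%N]],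
            [set Lambda X (a_ k * (c *: Umon X m)) | k in [set k | (N <= k)%N]]) => /=.
      by split; exists N => // k Nk; exists k.
    move=> [_ _] /= [[k Nk <-] [l Nl <-]].
    rewrite -ball_normE /= -linearB -mulrBl/= -scalerAr linearZ/= normrZ.
    rewrite norm_Lambda_unitary; last exact: Umon_unitary.
    have kl : `|Lambda X (a_ k - a_ l)| < e / (`|c| + 1).
      rewrite linearB/= [ltRHS]splitr -[Lambda X (a_ k)](subrK x) -addrA.
      by rewrite (le_lt_trans (ler_normD _ _))// ltrD ?aN// distrC aN.
    rewrite (@le_lt_trans _ _ ((`|c| + 1) * `|Lambda X (a_ k - a_ l)|))//.
      by rewrite ler_wpM2r// lerDl.
    by rewrite mulrC -ltr_pdivlMr.
  move=> /cvg_ex[z az]; exists z; exists (c *: Umon X m), a_; split=> //.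
  by rewrite linearZ.
(* From here [z] is an arbitrary limit with its own [b] and [a_]; of [b] only the value
   [Lambda b = c e_m] is known. *)
move: (xget 0 P) => z [b [a_ [bE ax az]]].
have /(_ _) zn := cvg_innerl (v := Ubasis n) az.
have /(_ _) xn := cvg_innerl (v := Lambda X (Umon X n * star (Umon X m))) ax.
rewrite -(cvg_lim (@norm_hausdorff _ _) zn).
have -> : (fun k => inner (Lambda X (a_ k * b)) (Ubasis n)) =
  (fun k => c * inner (Lambda X (a_ k)) (Lambda X (Umon X n * star (Umon X m)))).
  apply/funext => k; have bE' : Lambda X (c *: Umon X m) = Lambda X b by rewrite linearZ.
  rewrite -(Lambda_mulr_eq (a_ k) bE') -scalerAr linearZ/= innerZl !inner_Lambda.
  by rewrite starM starK -[in RHS]mulrA [in RHS]traceC mulrA.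
by apply: cvg_lim; [exact: norm_hausdorff|exact: cvgMr].
Qed.

Lemma funcalc_fourier (f : ('I_d -> R[i]) -> R[i]) x n :
  (forall xi, `|f (D_eigenvalue R xi)| <= 1) ->
  inner (funcalc f x) (Ubasis n) = f (D_eigenvalue R n) * inner x (Ubasis n).
Proof.
move=> f1; apply: (inner_orthonormal_series (y := x)
  (c := fun n => f (D_eigenvalue R n) * fourier2 x n)) => [|k].
  exact: basis_orthonormal.
by rewrite normrM ler_piMl.
Qed.

End torus_basis.

(** * Completeness of the monomials in [L_2] *)

Section torus_complete.
Variables (R : realType) (d : nat) (theta : 'M[R]_d) (X : quantumTorus theta).
Implicit Types (m n : 'rV[int]_d) (a b : CT X) (x y : L2 X).

Inductive monomial_span : CT X -> Prop :=
| span_monomial (c : R[i]) n : monomial_span (c *: Umon X n)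
| span_add a b : monomial_span a -> monomial_span b -> monomial_span (a + b).

Lemma span_phase (c : R[i]) a n : phase_eq a (Umon X n) -> monomial_span (c *: a).
Proof. by move=> [w _ ->]; rewrite scalerA; exact: span_monomial. Qed.

Lemma span_scale (c : R[i]) a : monomial_span a -> monomial_span (c *: a).
Proof.
by elim=> [w n|b b' _ IH _ IH']; [rewrite scalerA; exact: span_monomial|
  rewrite scalerDr; exact: span_add].
Qed.

Lemma span_mul a b : monomial_span a -> monomial_span b -> monomial_span (a * b).
Proof.
move=> sa sb; elim: sa => [w n|a1 a2 _ IH1 _ IH2]; last first.
  by rewrite mulrDl; exact: span_add.
elim: sb => [z m|b1 b2 _ IH1 _ IH2]; last by rewrite mulrDr; exact: span_add.
by rewrite -scalerAl -scalerAr scalerA; apply: span_phase; exact: UmonM.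
Qed.

Lemma span_star a : monomial_span a -> monomial_span (star a).
Proof.
elim=> [w n|b b' _ IH _ IH']; last by rewrite starD; exact: span_add.
by rewrite starZ; apply: span_phase; exact: star_Umon.
Qed.

Lemma gen_Umon j : @gen _ _ _ X j = Umon X (delta_mx 0 j).
Proof.
rewrite /Umon /monomial (@big_only1 _ _ _ _ j)//= => [|i ij _].
  by rewrite mxE !eqxx.
by rewrite mxE (negbTE ij).
Qed.

(** The norm closure of the span is a closed star-subalgebra containing the generators, hence
    everything by [gen_generate]. *)
Lemma monomial_span_dense a (e : R[i]) : 0 < e ->
  exists2 b, monomial_span b & cnorm (a - b) < e.
Proof.
move=> e0; pose S a := forall e : R[i], 0 < e -> exists2 b, monomial_span b & cnorm (a - b) < e.
suff : S a by exact.
have spanS b : monomial_span b -> S b.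
  move=> sb e' e'0; exists b => //; rewrite subrr.
  by rewrite -(scale0r b) cnormZ normr0 mul0r.
have -> : S = setT :> set (CT X); last by [].
apply: (@gen_generate _ _ _ X); last first.
  by move=> j; apply: spanS; rewrite gen_Umon -[Umon _ _]scale1r; exact: span_monomial.
split.
- by apply: spanS; rewrite -(Umon0 X) -[Umon _ _]scale1r; exact: span_monomial.
- move=> b b' Sb Sb'; split=> e' e'0.
    have h0 : 0 < e' / 2 by rewrite divr_gt0.
    have [c sc bc] := Sb _ h0; have [c' sc' bc'] := Sb' _ h0.
    exists (c + c'); first exact: span_add.
    by rewrite opprD addrACA (le_lt_trans (cnormD _ _))// [e']splitr ltrD.
  (* In [b b' - c c' = b (b' - c') + (b - c) c'], first [c'] is chosen against [|b|], then [c]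
     against [|c'|]. *)
  have k0 : 0 < cnorm b + 1 by rewrite ltr_wpDl// cnorm_ge0.
  have [c' sc' bc'] := Sb' _ (divr_gt0 (divr_gt0 e'0 (ltr0Sn _ 1)) k0).
  have l0 : 0 < cnorm c' + 1 by rewrite ltr_wpDl// cnorm_ge0.
  have [c sc bc] := Sb _ (divr_gt0 (divr_gt0 e'0 (ltr0Sn _ 1)) l0).
  exists (c * c'); first exact: span_mul.
  rewrite -(subrK (b * c') (b * b')) -addrA -mulrBr -mulrBl.
  rewrite (le_lt_trans (cnormD _ _))// [e']splitr ltrD//.
    rewrite (le_lt_trans (cnormM _ _))//.
    rewrite (@le_lt_trans _ _ ((cnorm b + 1) * cnorm (b' - c')))//.
      by rewrite ler_wpM2r ?cnorm_ge0// lerDl.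
    by rewrite mulrC -ltr_pdivlMr.
  rewrite (le_lt_trans (cnormM _ _))//.
  rewrite (@le_lt_trans _ _ (cnorm (b - c) * (cnorm c' + 1)))//.
    by rewrite ler_wpM2l ?cnorm_ge0// lerDl.
  by rewrite -ltr_pdivlMr.
- move=> w b Sb e' e'0.
  have k0 : 0 < `|w| + 1 by rewrite ltr_wpDl.
  have [c sc bc] := Sb _ (divr_gt0 e'0 k0).
  exists (w *: c); first exact: span_scale.
  rewrite -scalerBr cnormZ (@le_lt_trans _ _ ((`|w| + 1) * cnorm (b - c)))//.
    by rewrite ler_wpM2r ?cnorm_ge0// lerDl.
  by rewrite mulrC -ltr_pdivlMr.
- move=> b Sb e' e'0; have [c sc bc] := Sb _ e'0.
  by exists (star c); [exact: span_star|rewrite -starB cnorm_starE].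
- move=> b_ b Sb bb e' e'0.
  have h0 : 0 < e' / 2 by rewrite divr_gt0.
  have [N _ /(_ N (leqnn N)) bN] := bb _ h0; have [c sc bc] := Sb N _ h0.
  exists c => //; rewrite -(subrK (b_ N) b) -addrA (le_lt_trans (cnormD _ _))//.
  rewrite [e']splitr ltrD//.
  by rewrite -opprB -scaleN1r cnormZ normrN1 mul1r.
Qed.

(** Such a [y] is orthogonal to a dense set. If [y != 0], some [Lambda b] in that set is closer to
    [y] than [|y|], and [|y|^2 = <y, y - Lambda b> < |y|^2]. *)
Lemma basis_complete y : (forall n, inner y (Ubasis X n) = 0) -> y = 0.
Proof.
move=> y0.
have span0 b : monomial_span b -> inner y (Lambda X b) = 0.
  elim=> [c n|b1 b2 _ IH1 _ IH2]; first by rewrite linearZ/= innerZr y0 mulr0.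
  by rewrite linearD/= innerDr IH1 IH2 addr0.
have [->//|ny] := eqVneq y 0; have y1 : 0 < `|y| by rewrite normr_gt0.
have e0 : 0 < `|y| / 2 by rewrite divr_gt0.
have [a_ /cvgrPdist_lt/(_ _ e0)[N _ /(_ N (leqnn N)) /= yN]] := Lambda_dense_seq y.
have [b /span0 b0 ab] := monomial_span_dense (a_ N) e0.
have yb : `|y - Lambda X b| < `|y|.
  rewrite -(subrK (Lambda X (a_ N)) y) -addrA (le_lt_trans (ler_normD _ _))//.
  rewrite subrK [ltRHS]splitr ltrD// -linearB (le_lt_trans _ ab)//.
  exact: norm_Lambda_le.
have : `|y| ^+ 2 <= `|y| * `|y - Lambda X b|.
  have := CauchySchwarz_inner y (y - Lambda X b).
  by rewrite innerBr b0 subr0 -sqr_norm ger0_norm ?exprn_ge0.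
by rewrite expr2 ler_pM2l// => /le_lt_trans/(_ yb); rewrite ltxx.
Qed.

End torus_complete.

(** * Differences of lattice directions *)

Section lattice_directions.
Variables (R : realType) (d : nat).
Implicit Types (m n q : 'rV[int]_d).

Lemma sqr_euclid n : euclid R n ^+ 2 = \sum_j (n 0 j)%:~R ^+ 2.
Proof. by rewrite sqr_sqrtr// sumr_ge0// => j _; rewrite sqr_ge0. Qed.

Lemma euclid_ge0 n : 0 <= euclid R n.
Proof. exact: sqrtr_ge0. Qed.

Lemma coord_le_euclid n j : `|(n 0 j)%:~R| <= euclid R n.
Proof.
rewrite -(@ler_pXn2r _ 2)// ?nnegrE ?euclid_ge0// sqr_euclid real_normK ?num_real//.
by rewrite (bigD1 j)//= lerDl sumr_ge0// => i _; rewrite sqr_ge0.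
Qed.

Lemma euclid_le_sum n : euclid R n <= \sum_j `|(n 0 j)%:~R|.
Proof.
rewrite -(@ler_pXn2r _ 2)// ?nnegrE ?euclid_ge0 ?sumr_ge0// sqr_euclid expr2 mulr_suml.
apply: ler_sum => j _; rewrite -[leLHS]real_normK ?num_real// expr2 ler_wpM2l//.
by rewrite (bigD1 j)//= lerDl sumr_ge0.
Qed.

(** With [P] and [Q] the two norms, [P^2 - Q^2] is a sum of terms [q_j ((n + q)_j + n_j)], each of
    modulus at most [|q_j| (P + Q)]. *)
Lemma euclid_lipschitz n q :
  `|euclid R (n + q) - euclid R n| <= \sum_j `|(q 0 j)%:~R|.
Proof.
set P := euclid R (n + q); set Q := euclid R n.
have P0 : 0 <= P by exact: euclid_ge0.
have Q0 : 0 <= Q by exact: euclid_ge0.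
have [PQ|PQ] := eqVneq (P + Q) 0.
  have -> : P = Q by lra.
  by rewrite subrr normr0 sumr_ge0.
have PQ0 : 0 < P + Q by rewrite lt_neqAle eq_sym PQ addr_ge0.
rewrite -(ler_pM2r PQ0) -{1}(ger0_norm (ltW PQ0)) -normrM.
have -> : (P - Q) * (P + Q) = P ^+ 2 - Q ^+ 2 by ring.
rewrite !sqr_euclid -sumrB mulr_suml (le_trans (ler_norm_sum _ _ _))//.
apply: ler_sum => j _; rewrite subr_sqr mxE rmorphD/= normrM addrAC subrr add0r.
rewrite ler_wpM2l// (le_trans (ler_normD _ _))// lerD//; last exact: coord_le_euclid.
by have := coord_le_euclid (n + q) j; rewrite mxE rmorphD.
Qed.

(** At [n = 0] division by zero gives [0], as in [riesz]. *)
Definition direction n j : R := (n 0 j)%:~R / euclid R n.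

Lemma direction_le1 n j : `|direction n j| <= 1.
Proof.
have [n0|n0] := eqVneq (euclid R n) 0.
  by rewrite /direction n0 invr0 mulr0 normr0 ler01.
have n1 : 0 < euclid R n by rewrite lt_neqAle eq_sym n0 euclid_ge0.
by rewrite normrM normfV (gtr0_norm n1) ler_pdivrMr// mul1r coord_le_euclid.
Qed.

(* In the box [0, K)^d shifted by [2 L K] in the coordinates other than [b], with
   [L = \sum_a |q_a|], the coordinate [b] is so small that
   [q_b |m| - m_b (|m + q| - |m|)], the numerator of the difference of directions,
   has the sign of [q_b]. *)
Lemma direction_gap q b : (2 <= d)%N -> q 0 b != 0 ->
  exists2 c : R, 0 < c & forall K, (0 < K)%N ->
    exists2 s : {ffun 'I_d -> 'I_K} -> 'rV[int]_d, injective s &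
    forall l, c / K%:R <= Num.sg (q 0 b)%:~R * (direction (s l + q) b - direction (s l) b).
Proof.
move=> d2 qb; pose L : nat := \sum_a `|q 0%R a|%N.
have LE : L%:R = \sum_j `|(q 0 j)%:~R| :> R.
  rewrite natr_sum; apply: eq_bigr => j _.
  by rewrite -intr_norm -abszE.
have qb1 : 1 <= `|(q 0 b)%:~R| :> R by rewrite -intr_norm ler1z; move: qb; lia.
have L1 : 1 <= L%:R :> R.
  by rewrite LE (bigD1 b)//= (le_trans qb1)// lerDl sumr_ge0.
(* [C K] bounds [|m + q|]: each of the [d] coordinates of [m] is at most [(2 L + 1) K], and [q] adds
   at most [L <= L K]. *)
pose C : R := d%:R * (2 * L%:R + 1) + L%:R.
have C1 : 1 <= C by rewrite /C (le_trans L1)// lerDr mulr_ge0// addr_ge0// mulr_ge0.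
exists (2 * C)^-1 => [|K K0]; first by rewrite invr_gt0; lra.
pose s (l : {ffun 'I_d -> 'I_K}) : 'rV[int]_d :=
  \row_a ((if a == b then 0 else 2 * L * K)%N + l a)%N%:Z.
exists s => [l l' /rowP ll'|l].
  apply/ffunP => a; apply: val_inj; have := ll' a; rewrite !mxE => -[].
  by move/addnI.
have K1 : 1 <= K%:R :> R by rewrite ler1n.
(* A second coordinate exists as [d >= 2]; being at least [2 L K], it bounds [|m|] from below. *)
have [a ab] : exists a : 'I_d, a != b.
  case: d d2 b {qb L LE qb1 L1 C C1 s l q} => [|[|d']]//= _ b.
  by exists (if b == ord0 then ord_max else ord0); have [->|] := eqVneq b ord0; rewrite // eq_sym.
pose x : R := (s l 0 b)%:~R.
have mb : 0 <= x <= K%:R.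
  by rewrite /x mxE eqxx add0n -pmulrn ler0n ler_nat ltnW.
have Qlow : 2 * L%:R * K%:R <= euclid R (s l).
  apply: le_trans (coord_le_euclid _ a); apply: le_trans (ler_norm _).
  by rewrite mxE (negbTE ab) -pmulrn -!natrM ler_nat leq_addr.
have Qup : euclid R (s l) <= d%:R * (2 * L%:R + 1) * K%:R.
  apply: (le_trans (euclid_le_sum _)).
  rewrite -[d in leRHS]card_ord -mulrA mulr_natl -sumr_const; apply: ler_sum => j _.
  rewrite mxE -pmulrn ger0_norm ?ler0n// natrD mulrDl mul1r lerD//.
    by case: ifP => _; rewrite -!natrM ler_nat.
  by rewrite ler_nat ltnW.
have := euclid_lipschitz (s l) q; rewrite -LE ler_norml => /andP[PQ1 PQ2].
rewrite /direction; set Q := euclid R (s l) in Qlow Qup PQ1 PQ2 *.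
set P := euclid R (s l + q) in PQ1 PQ2 *.
rewrite mxE rmorphD/= -/x.
set y : R := (q 0 b)%:~R in qb1 *.
have LK : L%:R <= L%:R * K%:R :> R by rewrite ler_peMr//; lra.
have Q0 : 0 < Q by lra.
have P0 : 0 < P by lra.
have PC : P <= C * K%:R by rewrite /C mulrDl; lra.
have -> : Num.sg y * ((x + y) / P - x / Q) =
    (Num.sg y * y * Q - x * (Num.sg y * (P - Q))) / (P * Q).
  by field; rewrite !gt_eqF.
have -> : Num.sg y * y = `|y| by rewrite [in RHS]normrEsg.
have h : x * (Num.sg y * (P - Q)) <= L%:R * K%:R.
  have h1 : `|Num.sg y * (P - Q)| <= L%:R.
    rewrite normrM normr_sg; case: (y != 0); rewrite ?mul1r ?mul0r ?ler0n//.
    by rewrite ler_norml PQ1.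
  move: mb => /andP[x0 xK].
  rewrite mulrC (le_trans (ler_norm _))// normrM (ger0_norm x0) ler_pM//.
(* The numerator is at least [Q - L K >= Q / 2], which leaves [1 / (2 P)] after division by
   [P Q]. *)
apply: (@le_trans _ _ (2 * P)^-1).
  rewrite -invfM lef_pV2 ?posrE; [|nra|nra].
  by rewrite -mulrA ler_wpM2l.
rewrite ler_pdivlMr ?mulr_gt0//.
have -> : (2 * P)^-1 * (P * Q) = Q / 2 by field; rewrite gt_eqF.
have : Q <= `|y| * Q by rewrite ler_peMl// ltW.
lra.
Qed.

End lattice_directions.

(** * Matrix coefficients of the quantised differential *)

Section qdiff_entries.
Variables (R : realType) (d : nat) (theta : 'M[R]_d) (X : quantumTorus theta).
Variables (N : nat) (gamma : 'I_d -> 'M[R[i]]_N).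
Implicit Types (m n : 'rV[int]_d) (x : L2 X).

Lemma D_eigenvalueE n j : D_eigenvalue R n j = (2 * pi * (n 0 j)%:~R : R)%:C.
Proof.
rewrite /D_eigenvalue !rmorphM/= rmorph_int rmorph_nat.
have i2 : ('i%C : R[i]) * 'i%C = -1 by rewrite -expr2 sqr_i.
set z : R[i] := (n 0 j)%:~R; set p : R[i] := pi%:C.
have -> : - 'i%C * (2 * p * 'i%C * z) = - (2 * p * z) * ('i%C * 'i%C) by ring.
by rewrite i2 mulrN1 opprK.
Qed.

Lemma riesz_D_eigenvalue n j : riesz j (D_eigenvalue R n) = (direction R n j)%:C.
Proof.
have pi0 : 0 < 2 * pi :> R by rewrite mulr_gt0// pi_gt0.
rewrite /riesz.
have -> : \sum_k D_eigenvalue R n k ^+ 2 = ((2 * pi * euclid R n)%:C) ^+ 2.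
  rewrite -rmorphXn exprMn sqr_euclid mulr_sumr rmorph_sum; apply: eq_bigr => k _.
  by rewrite D_eigenvalueE -rmorphXn exprMn.
rewrite sqrCK ?ler0c ?mulr_ge0 ?euclid_ge0 ?pi_ge0// D_eigenvalueE -fmorph_div.
by rewrite -mulf_div divff ?mul1r// gt_eqF.
Qed.

Lemma riesz_le1 (j : 'I_d) n : `|riesz j (D_eigenvalue R n)| <= 1.
Proof.
by rewrite riesz_D_eigenvalue normc_def/= expr0n addr0 sqrtr_sqr lecR direction_le1.
Qed.

Definition spinor_basis (k : 'I_N) m : hsum N (L2 X) :=
  [ffun i => (i == k)%:R *: Ubasis X m].

Lemma spinor_basis_orthonormal k : orthonormal_family (spinor_basis k).
Proof.
move=> m n; rewrite /inner/= /hsum_inner (bigD1 k)//= big1 ?addr0 => [|i ik].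
  by rewrite !ffunE eqxx !scale1r basis_orthonormal.
by rewrite !ffunE (negbTE ik) scale0r inner0l.
Qed.

Lemma inner_spinor_basis k m (eta : hsum N (L2 X)) :
  inner eta (spinor_basis k m) = inner (eta k) (Ubasis X m).
Proof.
rewrite {1}/inner/= /hsum_inner (bigD1 k)//= big1 ?addr0 => [|i ik].
  by rewrite ffunE eqxx scale1r.
by rewrite ffunE (negbTE ik) scale0r inner0r.
Qed.

Lemma spinor_basis_smooth k m : smooth_spinor (spinor_basis k m).
Proof.
move=> i; exists ((i == k)%:R *: Umon X m); last by rewrite ffunE linearZ.
(* Only the coefficient at [m] can be nonzero, whence this constant. *)
move=> r; exists ((1 + euclid R m) ^+ r) => n.
have E0 : 0 <= 1 + euclid R m by rewrite addr_ge0// euclid_ge0.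
rewrite /fourier -scalerAl linearZ/= normrM.
rewrite traceC -inner_Lambda -!/(Ubasis X _) basis_orthonormal.
have [<-|mn] := eqVneq m n; last first.
  by rewrite normr0 mulr0 mul0r ler0c exprn_ge0.
rewrite normr1 mulr1 ler_piMl ?ler0c ?exprn_ge0//.
by rewrite normr_nat lern1 leq_b1.
Qed.

Lemma funcalc_Ubasis (f : ('I_d -> R[i]) -> R[i]) (c : R[i]) m :
  (forall xi, `|f (D_eigenvalue R xi)| <= 1) ->
  funcalc f (c *: Ubasis X m) = (f (D_eigenvalue R m) * c) *: Ubasis X m.
Proof.
move=> f1; apply/eqP; rewrite -subr_eq0; apply/eqP; apply: (@basis_complete _ _ _ X) => n.
rewrite innerBl funcalc_fourier// !innerZl basis_orthonormal.
have [->|_] := eqVneq m n; first by rewrite mulrA subrr.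
by rewrite !mulr0 subrr.
Qed.

(** [sgnD] acts on the spinors over [e_n] by the matrix [s n], so the two terms of the commutator
    give [s n] and [s m] times the same coefficient of [x]. *)
Lemma qdiff_entry x i k m n :
  inner (qdiff gamma x (spinor_basis k m) i) (Ubasis X n) =
  'i%C * (\sum_j gamma j i k * (direction R n j - direction R m j)%:C) *
    inner x (Lambda X (Umon X n * star (Umon X m))).
Proof.
set W := inner x _.
have sgnE : sgnD gamma (spinor_basis k m) i =
    (\sum_j gamma j i k * (direction R m j)%:C) *: Ubasis X m.
  rewrite ffunE scaler_suml; apply: eq_bigr => j _.
  rewrite (bigD1 k)//= big1 ?addr0 => [|k' kk']; rewrite ffunE funcalc_Ubasis; try exact: riesz_le1.
    by rewrite eqxx mulr1 riesz_D_eigenvalue scalerA.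
  by rewrite (negbTE kk') mulr0 scale0r scaler0.
have subE (u v : hsum N (L2 X)) : ('i%C *: u - 'i%C *: v) i = 'i%C *: u i - 'i%C *: v i.
  by rewrite !ffunE.
have mulopE u : mulop x u i = mulL2 x (u i) by rewrite ffunE.
rewrite /qdiff subE mulopE sgnE innerBl !innerZl mulL2_fourier -/W {1}ffunE inner_suml.
(* Here [sgnD] acts on a vector that need not be a basis vector; its coefficients at [e_n]
   suffice. *)
have -> : \sum_j inner (\sum_k0 gamma j i k0 *: funcalc (riesz j)
      (mulop x (spinor_basis k m) k0)) (Ubasis X n) =
    (\sum_j gamma j i k * (direction R n j)%:C) * W.
  rewrite mulr_suml; apply: eq_bigr => j _.
  rewrite inner_suml (bigD1 k)//= big1 ?addr0 => [|k' kk'];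
    rewrite innerZl funcalc_fourier; try exact: riesz_le1;
    rewrite !ffunE mulL2_fourier -/W riesz_D_eigenvalue.
    by rewrite eqxx mul1r mulrA.
  by rewrite (negbTE kk') mul0r !mulr0.
rewrite -!mulrA -mulrBr -mulrBl -sumrB; congr (_ * (_ * _)).
by apply: eq_bigr => j _; rewrite rmorphB/= mulrBr.
Qed.

End qdiff_entries.

(** * Traces of products of Clifford matrices *)

Section clifford_trace.
Variables (R : realType) (d N : nat) (gamma : 'I_d -> 'M[R[i]]_N).

(** By cyclicity both products in the anticommutation relation have the same trace. *)
Lemma clifford_trace b j : clifford gamma ->
  \tr (gamma b *m gamma j) = (j == b)%:R * N%:R.
Proof.
move=> [_ /(_ b j)/(congr1 mxtrace)].
rewrite linearD/= [\tr (gamma j *m _)]mxtrace_mulC -mulr2n mxtrace_scalar => E.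
by apply: (@pmulrnI _ 2) => //; rewrite E eq_sym -[LHS]mulr_natr -[RHS]mulr_natr -mulrA mulrC.
Qed.

End clifford_trace.

(** * Sums of coefficients of the quantised differential along a shift *)

Section nonconstant.
Variables (R : realType) (d : nat) (theta : 'M[R]_d) (X : quantumTorus theta).
Variables (N : nat) (gamma : 'I_d -> 'M[R[i]]_N) (x : L2 X).

(** [U^(m+q) * star (U^m)] is [U^q] up to a phase, which depends on [m] and is kept as [w] for later
    cancellation. *)
Lemma inner_shift m q : exists w : R[i], w * Num.conj w = 1 /\
  inner x (Lambda X (Umon X (m + q) * star (Umon X m))) =
    Num.conj w * inner x (Ubasis X q).
Proof.
have [w w1 E] : phase_eq (Umon X (m + q) * star (Umon X m)) (Umon X q).
  rewrite -[in Umon X q](addrK m q) [q + m]addrC.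
  apply: phase_trans (UmonM _ _ _); apply: phaseM; first exact: phase_refl.
  exact: star_Umon.
by exists w; rewrite -?normCK ?w1 ?expr1n// E linearZ/= innerZr.
Qed.

(* The sum is the trace pairing of the quantised differential with the families
   [e_k (x) e_m] and [e_i (x) e_(m+q)], the latter rotated to cancel the phases. *)
Lemma qdiff_diagonal_little_o (p e : R) q :
  (2 <= d)%N -> 0 < p <= d%:R -> qdiff_in_schatten gamma p x -> 0 < e ->
  exists J, forall s : {ffun 'I_d -> 'I_(2 ^ J)} -> 'rV[int]_d, injective s ->
    forall i k, `|inner x (Ubasis X q) * \sum_l \sum_j gamma j i k *
      (direction R (s l + q) j - direction R (s l) j)%:C| <= (e * (2 ^+ J) ^+ d.-1)%:C.
Proof.
move=> d2 pd [T [Tc Tq Tp]] e0.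
have [J /(_ J (leqnn J)) TJ] := trace_little_o d2 Tc Tp pd e0.
exists J => s s_inj i k.
have /choice[w wP] := fun l => inner_shift (s l) q.
have cI : #|{ffun 'I_d -> 'I_(2 ^ J)}| = (2 ^ (J * d))%N.
  by rewrite card_ffun !card_ord expnM.
have fo : orthonormal_family (fun l => spinor_basis X k (s l)).
  exact: orthonormal_comp s_inj (spinor_basis_orthonormal X k).
have go : orthonormal_family (fun l => Num.conj (w l) *: spinor_basis X i (s l + q)).
  move=> l l'; rewrite innerZl innerZr spinor_basis_orthonormal.
  rewrite (inj_eq (addIr q)) (inj_eq s_inj) conjCK.
  have [->|_] := eqVneq l l'; last by rewrite !mulr0.
  by rewrite mulr1 mulrC; have [] := wP l'.
have := TJ _ _ _ cI fo go.
have -> : \sum_l inner (T (spinor_basis X k (s l)))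
      (Num.conj (w l) *: spinor_basis X i (s l + q)) =
    'i%C * (inner x (Ubasis X q) * \sum_l \sum_j gamma j i k *
      (direction R (s l + q) j - direction R (s l) j)%:C).
  rewrite !mulr_sumr; apply: eq_bigr => l _; have [w1 xq] := wP l.
  rewrite innerZr conjCK Tq; last exact: spinor_basis_smooth.
  rewrite inner_spinor_basis qdiff_entry xq; set S := \sum_j _; set y := inner x _.
  have -> : w l * ('i%C * S * (Num.conj (w l) * y)) = (w l * Num.conj (w l)) * ('i%C * (y * S)).
    by ring.
  by rewrite w1 mul1r.
by rewrite normrM normc_def/= expr0n add0r expr1n sqrtr1 mul1r.
Qed.

End nonconstant.

(** * Vanishing of the nonconstant coefficients *)

Theorem corollary1p5 (R : realType) (d : nat) (theta : 'M[R]_d)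
  (X : quantumTorus theta) (gamma : 'I_d -> 'M[R[i]]_(2 ^ d./2))
  (p : R) (x : L2 X) :
  (2 <= d)%N -> theta^T = - theta -> clifford gamma -> 0 < p <= d%:R ->
  qdiff_in_schatten gamma p x ->
  exists c : R[i], x = c *: Lambda X 1.
Proof.
move=> d2 _ cliff pd xp.
(* By completeness, [x] then equals its component along [e_0 = Lambda 1]. *)
suff x0 q : q != 0 -> inner x (Ubasis X q) = 0.
  exists (inner x (Ubasis X 0)); apply/eqP; rewrite -subr_eq0; apply/eqP.
  apply: (@basis_complete _ _ _ X) => n.
  rewrite -(Umon0 X) innerBl innerZl -/(Ubasis X 0) basis_orthonormal.
  have [<-|n0] := eqVneq 0 n; first by rewrite mulr1 subrr.
  by rewrite mulr0 subr0 x0// eq_sym.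
move=> q0; have [b qb] : exists b, q 0 b != 0.
  apply/existsP; apply: contraNT q0; rewrite negb_exists => /forallP q0.
  by apply/eqP/rowP => b; rewrite mxE; apply/eqP; have := q0 b; rewrite negbK.
apply/eqP; apply/negPn/negP => xq0; pose a := complex.Re `|inner x (Ubasis X q)|.
have aE : `|inner x (Ubasis X q)| = a%:C by rewrite RRe_real.
have a0 : 0 < a by rewrite -(@ltcR R) -aE normr_gt0.
have [c c0 gap] := @direction_gap R d q b d2 qb.
pose N := (2 ^ d./2)%N; have N0 : 0 < N%:R :> R by rewrite ltr0n expn_gt0.
(* The entrywise bounds will be combined with the weights [gamma b k i], at the cost of the factor
   [G]. *)
pose G := complex.Re (\sum_k \sum_i `|gamma b k i|).
have GE : \sum_k \sum_i `|gamma b k i| = G%:C.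
  by rewrite RRe_real// ger0_real// sumr_ge0// => k _; rewrite sumr_ge0.
have G0 : 0 <= G.
  by rewrite -ler0c -GE sumr_ge0// => k _; rewrite sumr_ge0.
(* With this value of [e], the upper bound [G e Q] is [G / (G + 1) < 1] times the lower bound
   [a N c Q]; the [+ 1] covers [G = 0]. *)
have e0 : 0 < a * N%:R * c / (G + 1) by rewrite divr_gt0 ?mulr_gt0// ltr_wpDl.
have [J] := qdiff_diagonal_little_o q d2 pd xp e0.
have [|s s_inj sc /(_ _ s_inj) le_e] := gap (2 ^ J)%N; first by rewrite expn_gt0.
pose t l j : R := direction R (s l + q) j - direction R (s l) j.
(* Pairing with [gamma b] turns the entries into traces, of which only [j = b] survives. *)
have trE : \sum_k \sum_i gamma b k i * \sum_l \sum_j gamma j i k * (t l j)%:C =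
    N%:R * (\sum_l t l b)%:C.
  have -> : \sum_k \sum_i gamma b k i * \sum_l \sum_j gamma j i k * (t l j)%:C =
      \sum_l \sum_j \tr (gamma b *m gamma j) * (t l j)%:C.
    transitivity (\sum_l \sum_k \sum_i \sum_j gamma b k i * (gamma j i k * (t l j)%:C)).
      rewrite [RHS]exchange_big/=; apply: eq_bigr => k _.
      rewrite [RHS]exchange_big/=; apply: eq_bigr => i _.
      by rewrite mulr_sumr; apply: eq_bigr => l _; rewrite mulr_sumr.
    apply: eq_bigr => l _; symmetry.
    under eq_bigr => j _ do rewrite mulr_suml.
    rewrite exchange_big/=; apply: eq_bigr => k _.
    rewrite [RHS]exchange_big/=; apply: eq_bigr => j _.
    by rewrite mxE mulr_suml; apply: eq_bigr => i _; rewrite mulrA.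
  rewrite rmorph_sum mulr_sumr; apply: eq_bigr => l _.
  rewrite (bigD1 b)//= big1 ?addr0 => [|j jb]; rewrite clifford_trace//.
    by rewrite eqxx mul1r.
  by rewrite (negbTE jb) !mul0r.
pose Q : R := (2 ^+ J) ^+ d.-1; have Q0 : 0 < Q by rewrite !exprn_gt0.
(* [(2^J)^d] lattice points contribute at least [c / 2^J] each, all with the sign of [q_b]. *)
have tlow : c * Q <= `|\sum_l t l b|.
  apply: (@le_trans _ _ `|Num.sg (q 0 b)%:~R * \sum_l t l b|); last first.
    by rewrite normrM normr_sg ler_piMl// lern1 leq_b1.
  apply: (le_trans _ (ler_norm _)); rewrite mulr_sumr.
  apply: le_trans (ler_sum _ (fun l _ => sc l)).
  rewrite sumr_const card_ffun !card_ord -[leRHS]mulr_natr !natrX.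
  have x0 : 2 ^+ J != 0 :> R by rewrite expf_neq0.
  by rewrite -[in leRHS](prednK (ltnW d2)) exprS -mulrA mulKf.
have : a * N%:R * (c * Q) <= G * (a * N%:R * c / (G + 1) * Q).
  apply: (@le_trans _ _ (a * N%:R * `|\sum_l t l b|)).
    by rewrite ler_pM2l// mulr_gt0.
  rewrite -lecR; apply: (@le_trans _ _ `|\sum_k \sum_i gamma b k i *
      (inner x (Ubasis X q) * \sum_l \sum_j gamma j i k * (t l j)%:C)|).
    have -> : \sum_k \sum_i gamma b k i *
        (inner x (Ubasis X q) * \sum_l \sum_j gamma j i k * (t l j)%:C) =
        inner x (Ubasis X q) * (N%:R * (\sum_l t l b)%:C).
      rewrite -trE mulr_sumr; apply: eq_bigr => k _; rewrite mulr_sumr.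
      by apply: eq_bigr => i _; rewrite mulrCA.
    rewrite !normrM aE normr_nat.
    rewrite normc_def/= expr0n addr0 sqrtr_sqr.
    by rewrite -[N%:R as X in _ * (X * _)](rmorph_nat (real_complex R)) -!rmorphM mulrA.
  rewrite [leRHS]rmorphM/= -GE mulr_suml (le_trans (ler_norm_sum _ _ _))//.
  apply: ler_sum => k _; rewrite mulr_suml (le_trans (ler_norm_sum _ _ _))//.
  by apply: ler_sum => i _; rewrite normrM ler_wpM2l//; exact: le_e.
have y0 : 0 < a * N%:R * (c * Q) by rewrite !mulr_gt0.
have -> : G * (a * N%:R * c / (G + 1) * Q) = a * N%:R * (c * Q) * (G / (G + 1)).
  by field; rewrite gt_eqF// ltr_wpDl.
rewrite -[leLHS]mulr1 ler_pM2l// ler_pdivlMr ?mul1r ?ltr_wpDl//.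
lra.
Qed.
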